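(* Consider the multi-server speed-scaling problem described in the context with power function $P(s)=s^\alpha$ for some $\alpha\in(1,2)$. Consider the online algorithm that at every time $t$ serves, on $\min\{m,n(t)\}$ distinct servers, the $\min\{m,n(t)\}$ unfinished jobs with the shortest remaining sizes (SRPT, with migration allowed), where $n(t)$ is the number of unfinished jobs at time $t$; each busy server runs at speed $P^{-1}(n(t)/m)=(n(t)/m)^{1/\alpha}$ if $n(t)\ge m$ and at speed $P^{-1}(1)=1$ if $n(t)<m$, and idle servers run at speed $0$. Then this algorithm is $c$-competitive with $$c=3+\frac{2}{2-\alpha}.$$
   Context: There are $m$ identical servers, each of which can run at any speed $s\ge 0$ at power consumption $P(s)$; work is processed at rate $s$. A (finite) input instance $\sigma$ consists of jobs $j$ with release times $a_j$ and sizes $w_j>0$. Preemption and migration are allowed, but a job may be processed by at most one server at any time. The cost of a schedule is $C=\int n(t)\,dt+\int\sum_{k=1}^m P(s_k(t))\,dt$, where $n(t)$ is the number of released, unfinished jobs at time $t$ and $s_k(t)$ is the speed of server $k$. An online algorithm learns of job $j$ only at time $a_j$. $\mathsf{OPT}$ denotes the offline optimal schedule, which knows $\sigma$ in advance and minimizes $C$. An online algorithm $A$ is $c$-competitive if $C_A(\sigma)\le c\,C_{\mathsf{OPT}}(\sigma)$ for every input instance $\sigma$. *)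

(* Defs.v *)
From HB Require Import structures.
From mathcomp Require Import all_boot all_order all_algebra.
From mathcomp Require Import all_classical all_reals all_analysis.
Set Implicit Arguments. Unset Strict Implicit. Unset Printing Implicit Defensive.
Import Order.TTheory GRing.Theory Num.Theory.
Import numFieldNormedType.Exports.
Local Open Scope classical_set_scope.
Local Open Scope ring_scope.

(* Multi-server speed scaling.  m servers ('I_m), N jobs ('I_N).
   An instance is given by release times a : 'I_N -> R and sizes w : 'I_N -> R.
   A schedule gives, for every server k and time t, its speed and the job
   (if any) it processes. *)
Record schedule (R : realType) (m N : nat) := Schedule {
  speed  : 'I_m -> R -> R;
  assign : 'I_m -> R -> option 'I_N }.

Section Model.
Context {R : realType} {m N : nat}.

Definition power (alpha s : R) : R := s `^ alpha.

Definition rate (S : schedule R m N) (j : 'I_N) (t : R) : R :=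
  \sum_(k < m) (if assign S k t == Some j then speed S k t else 0).

Definition work (S : schedule R m N) (j : 'I_N) (t : R) : \bar R :=
  (\int[lebesgue_measure]_(u in `]-oo, t]) (rate S j u)%:E)%E.

Definition alive (a w : 'I_N -> R) (S : schedule R m N) (j : 'I_N) (t : R) : bool :=
  (a j <= t) && (work S j t < (w j)%:E)%E.

Definition alive_set (a w : 'I_N -> R) (S : schedule R m N) (t : R) : {set 'I_N} :=
  [set j | alive a w S j t].

Definition nalive (a w : 'I_N -> R) (S : schedule R m N) (t : R) : nat :=
  #|alive_set a w S t|.

Definition running (S : schedule R m N) (t : R) : {set 'I_N} :=
  [set j | [exists k, assign S k t == Some j]].

Definition remaining (w : 'I_N -> R) (S : schedule R m N) (j : 'I_N) (t : R) : \bar R :=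
  ((w j)%:E - work S j t)%E.

Definition feasible (a : 'I_N -> R) (S : schedule R m N) : Prop :=
  [/\ (forall k t, 0 <= speed S k t),
      (forall k, measurable_fun setT (speed S k)),
      (forall k j, measurable [set t | assign S k t = Some j]),
      (forall t k1 k2 j, assign S k1 t = Some j -> assign S k2 t = Some j -> k1 = k2)
    & (forall k t j, assign S k t = Some j -> a j <= t)].

Definition cost (alpha : R) (a w : 'I_N -> R) (S : schedule R m N) : \bar R :=
  (\int[lebesgue_measure]_(t in setT) ((nalive a w S t)%:R)%:E
   + \int[lebesgue_measure]_(t in setT) (\sum_(k < m) power alpha (speed S k t))%:E)%E.

Definition alg_schedule (alpha : R) (a w : 'I_N -> R) (S : schedule R m N) : Prop :=
  feasible a S /\
  forall t,
    let A := alive_set a w S t in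
    let n := #|A| in
    [/\ running S t \subset A,
        #|running S t| = minn m n,
        (forall j i, j \in running S t -> i \in A -> i \notin running S t ->
           (remaining w S j t <= remaining w S i t)%E)
      & (forall k, speed S k t =
           if assign S k t is Some _ then
             (if (m <= n)%N then power alpha^-1 (n%:R / m%:R) else 1)
           else 0)].

End Model.

(* Main.v *)
Require Import Defs.
From HB Require Import structures.
From mathcomp Require Import all_boot all_order all_algebra.
From mathcomp Require Import all_classical all_reals all_analysis.
From mathcomp Require Import measurable_realfun.
From mathcomp Require Import ring lra zify.
Import Order.TTheory GRing.Theory Num.Theory.
Import numFieldNormedType.Exports.
Local Open Scope ring_scope.
Set Implicit Arguments. Unset Strict Implicit. Unset Printing Implicit Defensive.

(** For a level [q > 0], let [n_q] and [o_q] be the numbers of jobs whose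
    remaining size is at least [q] in the algorithm's schedule and in the other
    schedule, and let [h v = c1 alpha (v/m)^(1 - 1/alpha)], [c1 = 2/(2 - alpha)].
    The potential is the integral over [q] of
    [h 1 + ... + h (n_q - o_q) + 2 (n_q - o_q)].  Instead of differentiating it
    in time, fix [q]: each job crosses the level [q] at most once in each
    schedule, and telescoping over these crossings compares the total decrease
    caused by the algorithm with the total increase caused by the other
    schedule.  The work done on a job, as a measure in time, is the image of
    Lebesgue measure on levels under the crossing time, so integrating over [q]
    turns the comparison into one between two time integrals, of [descent] and
    of [ascent].  At each time [2 n + ascent <= descent + c (o + power)] holds by
    Young's inequality and an arithmetic estimate on the ranks of the jobs being
    served, while the algorithm pays at most [2 n]. *)

(** * Telescoping and ranks *)

Section Telescope.
Context {R : realType} {d : Order.disp_t} {K : orderType d} {T : finType}.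
Context (h : nat -> R) (h0 : h 0%N = 0) (h_ge0 : forall v, 0 <= h v).
Context (side : pred T) (key : T -> K).

Let ca (X : {set T}) := #|[set e in X | side e]|.
Let cb (X : {set T}) := #|[set e in X | ~~ side e]|.

(* With [f n = \sum_(v < n.+1) h v], removing the events of [E] from [U] in
   increasing key order changes [f (ca - cb)] by [- h (ca - cb)] at an event of
   [side] and by [h (ca - (cb - 1))] at any other event; all subtractions are
   truncated, which is harmless since [h 0 = 0]. *)
Lemma telescoping_le (U E : {set T}) : E \subset U -> {in E &, injective key} ->
  \sum_(e in E | side e)
     h (ca (U :\: [set e' in E | (key e' < key e)%O])
        - cb (U :\: [set e' in E | (key e' < key e)%O]))
  <= \sum_(v < (ca U - cb U).+1) h v
     + \sum_(e in E | ~~ side e)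
     h (ca (U :\: [set e' in E | (key e' < key e)%O])
        - (cb (U :\: [set e' in E | (key e' < key e)%O])).-1).
Proof.
elim: {E}#|E| {-2}E U (erefl #|E|) => [|n IH] E U En EU kI.
  move/eqP: En; rewrite cards_eq0 => /eqP ->.
  rewrite [leLHS]big_pred0 => [|e]; last by rewrite inE.
  by rewrite addr_ge0// sumr_ge0.
have [x0 x0E] : exists x, x \in E by apply/card_gt0P; rewrite En.
(* Delete the earliest event from both [E] and [U]: by [aft], every later event still sees the same
   remaining set, and only this event changes the balance. *)
case: (Order.TotalTheory.arg_minP key x0E) => e0 e0E0 e0min; have e0E : e0 \in E := e0E0.
have En' : #|E :\ e0| = n by move: En; rewrite (cardsD1 e0) e0E; case.
have EU' : E :\ e0 \subset U :\ e0 by apply: finset.setSD.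
have kI' : {in E :\ e0 &, injective key}.
  by move=> x y /setD1P[_ xE] /setD1P[_ yE]; apply: kI.
have := IH _ _ En' EU' kI'.
have lt0 e : e \in E -> e != e0 -> (key e0 < key e)%O.
  move=> eE ne; rewrite lt_neqAle e0min// andbT; apply: contra ne => /eqP k.
  by rewrite (kI _ _ e0E eE k).
have aft e : e \in E -> e != e0 ->
    (U :\ e0) :\: [set e' in E :\ e0 | (key e' < key e)%O]
    = U :\: [set e' in E | (key e' < key e)%O].
  move=> eE ne; apply/setP => x; rewrite !inE.
  by have [->|_] := eqVneq x e0; rewrite ?e0E ?lt0.
have aft0 : U :\: [set e' in E | (key e' < key e0)%O] = U.
  apply/setP => x; rewrite !inE.
  by case: (boolP (x \in E)) => //= xE; rewrite ltNge e0min.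
have e0U : e0 \in U by apply: (fintype.subsetP EU).
have sumE (P : pred T) (F G : T -> R) :
   (forall e, e \in E -> e != e0 -> F e = G e) ->
   \sum_(e in E | P e) G e = (if P e0 then G e0 else 0) + \sum_(e in E :\ e0 | P e) F e.
  move=> FG; case: ifP => Pe0.
    rewrite (bigD1 e0) ?e0E//=; congr (_ + _).
    apply: eq_big => [e|e /andP[/andP[eE _] ne]]; last by rewrite FG.
    by rewrite !inE andbC andbA.
  rewrite add0r; apply: eq_big => [e|e /andP[eE Pe]]; last first.
    by rewrite FG//; apply: contraTN Pe => /eqP ->; rewrite Pe0.
  rewrite !inE; have [->|] := eqVneq e e0; by rewrite ?Pe0 ?andbF.
move=> le_IH.
rewrite (sumE _ (fun e => h (ca (U :\ e0 :\: [set e' in E :\ e0 | (key e' < key e)%O])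
        - cb (U :\ e0 :\: [set e' in E :\ e0 | (key e' < key e)%O])))); last first.
  by move=> e eE ne; rewrite aft.
rewrite [X in _ <= _ + X](sumE _ (fun e => h (ca (U :\ e0 :\: [set e' in E :\ e0 | (key e' < key e)%O])
        - (cb (U :\ e0 :\: [set e' in E :\ e0 | (key e' < key e)%O])).-1))); last first.
  by move=> e eE ne; rewrite aft.
rewrite aft0 addrCA addrA.
case: (boolP (side e0)) => s0 /=.
  have caU : ca U = (ca (U :\ e0)).+1.
    rewrite /ca (cardsD1 e0) inE e0U s0 add1n; congr _.+1.
    by apply: eq_card => x; rewrite !inE andbA.
  have cbU : cb U = cb (U :\ e0).
    apply: eq_card => x; rewrite !inE.
    by have [->|] := eqVneq x e0; rewrite ?s0 ?andbF.
  rewrite cbU caU add0r.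
  set a := ca _; set b := cb _.
  have -> : \sum_(v < (a.+1 - b).+1) h v = h (a.+1 - b)%N + \sum_(v < (a - b).+1) h v.
    (* If [a < b], both truncated differences are 0 and the extra summand is [h 0 = 0]. *)
    have [ba|ab] := leqP b a.
      by rewrite subSn// big_ord_recr/= addrC.
    by rewrite (eqP (_ : (a.+1 - b == 0)%N)) ?subn_eq0// (eqP (_ : (a - b == 0)%N)) ?h0 ?add0r// subn_eq0 ltnW.
  by rewrite -addrA lerD2l.
have caU : ca U = ca (U :\ e0).
  apply: eq_card => x; rewrite !inE.
  by have [->|] := eqVneq x e0; rewrite ?(negPf s0) ?andbF.
have cbU : cb U = (cb (U :\ e0)).+1.
  rewrite /cb (cardsD1 e0) inE e0U s0 add1n; congr _.+1.
  by apply: eq_card => x; rewrite !inE andbA.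
rewrite cbU caU add0r.
move: le_IH; set a := ca _; set b := cb _ => le_IH; rewrite -pred_Sn.
rewrite [h _ + _](_ : _ = \sum_(v < (a - b).+1) h v)//.
have [ba|ab] := ltnP b a.
  by rewrite [RHS]big_ord_recr/= addrC subnS prednK// subn_gt0.
by rewrite (eqP (_ : (a - b == 0)%N)) ?subn_eq0// (eqP (_ : (a - b.+1 == 0)%N)) ?subn_eq0 ?h0 ?add0r// ltnW.
Qed.

End Telescope.

Section Ranks.
Context {d : Order.disp_t} {K : orderType d} {T : finType} (key : T -> K).

Definition rank (A : {set T}) (j : T) : nat := #|[set i in A | (key j <= key i)%O]|.

(** Ranks are counted from above, so the [i]-th lowest element of a down-closed [L], counted from 0,
    has rank [#|A| - i]. The set [L] will be the jobs that SRPT serves. *)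
Lemma sum_rank_lower (A L : {set T}) (x : nat) :
  L \subset A -> {in A &, injective key} ->
  (forall j i, j \in L -> i \in A -> i \notin L -> (key j < key i)%O) ->
  (\sum_(j in L) (rank A j - x) = \sum_(i < #|L|) (#|A| - i - x))%N.
Proof.
move Ln: #|L| => n; elim: n L Ln => [|n IH] L Ln LA kI Ldown.
  move/eqP: Ln; rewrite cards_eq0 => /eqP ->; rewrite big_ord0 big_pred0//.
  by move=> e; rewrite inE.
have [x0 x0L] : exists x, x \in L by apply/card_gt0P; rewrite Ln.
case: (Order.TotalTheory.arg_maxP key x0L) => j0 j0L0 j0max.
have j0L : j0 \in L := j0L0.
have Ln' : #|L :\ j0| = n by move: Ln; rewrite (cardsD1 j0) j0L; case.
rewrite big_ord_recr/= (bigD1 j0)//= addnC; congr addn.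
  rewrite -(IH (L :\ j0))//.
  - by apply: eq_bigl => i; rewrite !inE andbC.
  - by apply: fintype.subset_trans LA; apply: subD1set.
  - move=> j i /setD1P[jn jL] iA; rewrite !inE negb_and negbK => /orP[/eqP ->|iL].
      rewrite lt_neqAle (j0max j jL : (key j <= key j0)%O) andbT.
      apply: contra jn => /eqP /kI ->//; exact: (fintype.subsetP LA).
    exact: Ldown.
congr subn; rewrite /rank.
have -> : [set i in A | (key j0 <= key i)%O] = A :\: (L :\ j0).
  apply/setP => i; rewrite !inE andbC.
  case: (boolP (i \in A)) => iA; rewrite ?andbF ?andbT//.
  case: (boolP (i \in L)) => iL; rewrite ?andbF ?andbT/=; last by rewrite ltW// Ldown.
  have [->|ij] := eqVneq i j0; first by rewrite lexx.
  apply/negbTE; rewrite -ltNge lt_neqAle (j0max i iL : (key i <= key j0)%O) andbT.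
  by apply: contra ij => /eqP /kI ->//; exact: (fintype.subsetP LA).
rewrite cardsD; congr subn; rewrite -Ln'; apply: eq_card => i.
by rewrite !inE; case: (boolP (i \in L)) => [/(fintype.subsetP LA) ->|]; rewrite ?andbF.
Qed.

Lemma rank_gt0 (A : {set T}) j : j \in A -> (0 < rank A j)%N.
Proof. by move=> jA; apply/card_gt0P; exists j; rewrite inE jA lexx. Qed.

(** The lowest element of [B] has all of [B] above it, so its rank is at least [#|B|]; remove it and
    repeat. The worst case is [B] at the top of [A]. *)
Lemma sum_rank_upper (A B : {set T}) (n : nat) : B \subset A ->
  {in A &, injective key} ->
  (\sum_(j in B) (n - (rank A j).-1) <= \sum_(i < #|B|) (n - i))%N.
Proof.
move Bb: #|B| => b; elim: b B Bb => [|b IH] B Bb BA kI.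
  move/eqP: Bb; rewrite cards_eq0 => /eqP ->; rewrite big_ord0 big_pred0//.
  by move=> e; rewrite inE.
have [x0 x0B] : exists x, x \in B by apply/card_gt0P; rewrite Bb.
case: (Order.TotalTheory.arg_minP key x0B) => j0 j0B0 j0min.
have j0B : j0 \in B := j0B0.
have Bb' : #|B :\ j0| = b by move: Bb; rewrite (cardsD1 j0) j0B; case.
rewrite big_ord_recr/= (bigD1 j0)//= addnC; apply: leq_add.
  rewrite (_ : (\sum_(i in B | i != j0) _ = \sum_(i in B :\ j0) (n - (rank A i).-1))%N); last first.
    by apply: eq_bigl => i; rewrite !inE andbC.
  by apply: IH => //; apply: fintype.subset_trans BA; apply: subD1set.
apply: leq_sub2l; rewrite -ltnS prednK; last by apply: rank_gt0; apply: (fintype.subsetP BA).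
rewrite -Bb; apply: subset_leq_card; apply/fintype.subsetP => i iB.
by rewrite inE (fintype.subsetP BA)//= j0min.
Qed.

End Ranks.

Lemma sum_sub_eq (n b : nat) : (b <= n)%N ->
  (2 * \sum_(i < b) (n - i) + b * b = 2 * b * n + b)%N.
Proof.
elim: b => [|b IH] bn; first by rewrite big_ord0.
by have := IH (ltnW bn); rewrite big_ord_recr/=; nia.
Qed.

Lemma sum_sub_ge (n m p : nat) : (p <= m)%N -> (p <= n)%N ->
  (2 * p * n + p <= 2 * \sum_(i < m) (n - i) + p * p)%N.
Proof.
move=> pm pn; rewrite -(sum_sub_eq pn) leq_add2r leq_mul2l/=.
rewrite -(big_mkord xpredT (fun i => (n - i)%N)) -(big_mkord xpredT (fun i => (n - i)%N)).
by rewrite (big_cat_nat (leq0n p) pm)/= leq_addr.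
Qed.

Lemma sum_sub_le (n b p : nat) : (b <= p)%N ->
  (\sum_(i < b) (n - i) <= \sum_(i < p) (n - i))%N.
Proof.
move=> bp.
rewrite -(big_mkord xpredT (fun i => (n - i)%N)) -(big_mkord xpredT (fun i => (n - i)%N)).
by rewrite (big_cat_nat (leq0n b) bp)/= leq_addr.
Qed.

(** * Arithmetic of the drift when all servers are busy *)

Section Arith.
Context {R : realFieldType}.

(** The drift bound once the powers of speeds are gone: the first sum comes from the other schedule,
    serving [b] alive jobs, the second from the algorithm. The first is bounded above by its
    extension to [min m o] terms, the second below by terms that are not truncated; the result is
    affine in [c]. *)
Lemma potential_arith (c : R) (n m o b : nat) : 2 <= c -> (0 < m)%N -> (m <= n)%N ->
  (b <= m)%N -> (b <= o)%N ->
  2 * n%:R + (c - 2) * ((\sum_(i < b) (n - i))%N%:R / m%:R) + 2 * b%:R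
  <= (2 * c - 2) * ((\sum_(i < m) (n - i - o))%N%:R / m%:R) + 2 * m%:R + (3 + c) * o%:R :> R.
Proof.
move=> c2 m0 mn bm bo.
under [in leRHS]eq_bigr do rewrite subnAC.
set S1 := (\sum_(i < b) _)%N; set S2 := (\sum_(i < m) _)%N.
have mR : 0 < m%:R :> R by rewrite ltr0n.
suff H : 2 * n%:R * m%:R + (c - 2) * S1%:R + 2 * b%:R * m%:R
      <= (2 * c - 2) * S2%:R + 2 * m%:R * m%:R + (3 + c) * o%:R * m%:R :> R.
  rewrite -(ler_pM2r mR); apply: le_trans (le_trans H _); rewrite le_eqVlt; apply/orP; left; apply/eqP; field; lra.
have S1n : (S1 <= b * n)%N by have := sum_sub_eq (leq_trans bm mn); rewrite -/S1; nia.
have [mo|om] := leqP m o.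
  have S1m : (2 * S1 + m * m <= 2 * m * n + m)%N.
    rewrite -(sum_sub_eq mn) leq_add2r leq_mul2l/=; exact: sum_sub_le.
  (* Truncation only increases the sum, so [S2] is at least its value with signed terms,
     [m * n - m * (m - 1) / 2 - m * o]. *)
  have S2m : (2 * m * n + m <= 2 * S2 + m * m + 2 * m * o)%N.
    have [no|on] := leqP n o; first by nia.
    have [mno|nom] := leqP m (n - o).
      have := @sum_sub_ge (n - o) m m (leqnn _) mno; rewrite -/S2; nia.
    have := @sum_sub_ge (n - o) m (n - o) (ltnW nom) (leqnn _); rewrite -/S2.
    have [e en] : exists e, n = (o + e)%N by exists (n - o)%N; lia.
    move: nom; rewrite en addKn => nom.
    have [z mz] : exists z, m = (e + z)%N by exists (m - e)%N; lia.
    rewrite mz; nia.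
  have S1R : 2 * S1%:R + m%:R * m%:R <= 2 * m%:R * n%:R + m%:R :> R.
    by rewrite -!natrM -!natrD ler_nat.
  have S2R : 2 * m%:R * n%:R + m%:R <= 2 * S2%:R + m%:R * m%:R + 2 * m%:R * o%:R :> R.
    by rewrite -!natrM -!natrD ler_nat.
  have S20 : 0 <= S2%:R :> R by rewrite ler0n.
  have m1 : 1 <= m%:R :> R by rewrite ler1n.
  have bR : b%:R <= m%:R :> R by rewrite ler_nat.
  have oR : m%:R <= o%:R :> R by rewrite ler_nat.
  move: c2 mR S1R S2R S20 m1 bR oR; set N' := n%:R; set M := m%:R; set O := o%:R.
  set B := b%:R; set s1 := S1%:R; set s2 := S2%:R => c2 mR S1R S2R S20 m1 bR oR.
  have h1 : (c - 2) * (2 * s1) <= (c - 2) * (2 * M * N' + M - M * M).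
    by apply: ler_wpM2l; lra.
  have h2 : c * (2 * M * N' + M - M * M - 2 * M * O) <= c * (2 * s2).
    by apply: ler_wpM2l; lra.
  have h3 : 0 <= (c - 2) * s2 by rewrite mulr_ge0//; lra.
  have h4 : B * M <= M * M by rewrite ler_wpM2r// ltW.
  have h5 : M * M <= O * M by rewrite ler_wpM2r// ltW.
  have h6 : M <= M * M by rewrite ler_peMr// ltW.
  nra.
have S1o : (2 * S1 + o * o <= 2 * o * n + o)%N.
  rewrite -(sum_sub_eq (ltnW (leq_trans om mn))) leq_add2r leq_mul2l/=; exact: sum_sub_le.
have S1R : 2 * S1%:R + o%:R * o%:R <= 2 * o%:R * n%:R + o%:R :> R.
  by rewrite -!natrM -!natrD ler_nat.
have bR : b%:R <= o%:R :> R by rewrite ler_nat.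
have oR : o%:R + 1 <= m%:R :> R by rewrite -[1]/1%:R -natrD ler_nat addn1.
have o0 : 0 <= o%:R :> R by rewrite ler0n.
have on : (o <= n)%N by lia.
have h1 : (c - 2) * (2 * S1%:R) <= (c - 2) * (2 * o%:R * n%:R + o%:R - o%:R * o%:R) :> R.
  by apply: ler_wpM2l; lra.
have h4 : b%:R * m%:R <= o%:R * m%:R :> R by rewrite ler_wpM2r// ltW.
have h5 : 0 <= o%:R * m%:R :> R by rewrite mulr_ge0// ltW.
have [e en] : exists e, n = (o + e)%N by exists (n - o)%N; lia.
have eR : n%:R = o%:R + e%:R :> R by rewrite en natrD.
have [mno|nom] := leqP m (n - o).
  have S2m := @sum_sub_ge (n - o) m m (leqnn _) mno.
  have S2R : 2 * m%:R * e%:R + m%:R <= 2 * S2%:R + m%:R * m%:R :> R.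
    by rewrite -!natrM -!natrD ler_nat; move: S2m; rewrite -/S2 en addKn.
  have mno' : m%:R <= e%:R :> R by move: mno; rewrite en addKn ler_nat.
  have h2 : (c - 1) * (2 * m%:R * e%:R + m%:R - m%:R * m%:R) <= (c - 1) * (2 * S2%:R) :> R.
    by apply: ler_wpM2l; lra.
  move: c2 mR S1R S2R bR oR o0 h1 h2 h4 h5 mno'; rewrite eR; set E := e%:R; set M := m%:R; set O := o%:R.
  set B := b%:R; set s1 := S1%:R; set s2 := S2%:R => c2 mR S1R S2R bR oR o0 h1 h2 h4 h5 mno'.
  (* The second factor is the coefficient of [c - 2] in the difference of the two sides, after
     inserting the bounds for both sums; the value at [c = 2] is left to [nra]. *)
  have h6 : 0 <= (c - 2) * (M * M + M - (O * O + O) / 2 + (2 * M - O) * (E - M)).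
    apply: mulr_ge0; first lra.
    have : 0 <= (2 * M - O) * (E - M) by apply: mulr_ge0; lra.
    nra.
  nra.
have S2m := @sum_sub_ge (n - o) m (n - o) (ltnW nom) (leqnn _).
have S2R : e%:R * e%:R + e%:R <= 2 * S2%:R :> R.
  by rewrite -!natrM -!natrD ler_nat; move: S2m; rewrite -/S2 en addKn; nia.
have e0 : 0 <= e%:R :> R by rewrite ler0n.
have h2 : (c - 1) * (e%:R * e%:R + e%:R) <= (c - 1) * (2 * S2%:R) :> R.
  by apply: ler_wpM2l; lra.
move: c2 mR S1R S2R bR oR o0 e0 h1 h2 h4 h5; rewrite eR; set E := e%:R; set M := m%:R; set O := o%:R.
set B := b%:R; set s1 := S1%:R; set s2 := S2%:R => c2 mR S1R S2R bR oR o0 e0 h1 h2 h4 h5.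
have h6 : 0 <= (c - 2) * (E * E + E + O * M - O * (O + E) + (O * O - O) / 2).
  apply: mulr_ge0; first lra.
  have : O * (O + 1) <= O * M by apply: ler_wpM2l.
  nra.
have h7 : 2 * E * M <= E * E + M * M by have := sqr_ge0 (E - M); nra.
nra.
Qed.

End Arith.

(** * Crossing times of a nonincreasing function *)

Section LastCrossing.
Local Open Scope classical_set_scope.
Context {R : realType} (X : R -> R) (w : R).
Context (Xc : continuous X) (Xn : {homo X : s t / s <= t >-> t <= s}).
Context (Xw : exists a, forall t, t < a -> X t = w).

(** For a continuous nonincreasing [X] starting at [w], these are the levels that are attained and
    later left downwards; low levels may never be left. *)
Definition levels : set R := [set q | q <= w /\ exists t, X t < q].
(* The last time at level at least [q], so that a job waiting at level [q] has
   not crossed it yet.  Meaningful only for [q] in [levels]. *)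
Definition crossing (q : R) : R := sup [set t | q <= X t].

Lemma crossing_has_sup q : levels q -> has_sup [set t | q <= X t].
Proof.
move=> [qw [t0 Xt0]]; split.
  by have [a aw] := Xw; exists (a - 1) => /=; rewrite aw// ltrBlDr ltrDl.
exists t0 => t /= qt; rewrite leNgt; apply/negP => /ltW /Xn tt0.
by move: (le_lt_trans (le_trans qt tt0) Xt0); rewrite ltxx.
Qed.

(** Continuity excludes both strict inequalities: with a value above [q] the set would extend past
    its supremum, and with a value below [q] no point of the set could be close to it. *)
Lemma crossingK q : levels q -> X (crossing q) = q.
Proof.
move=> Dq; have hs := crossing_has_sup Dq; apply/eqP; rewrite eq_le.
have Xcr := @Xc (crossing q); move/cvgrPdist_lt: Xcr => Xcr.
rewrite !leNgt; apply/andP; split; apply/negP => lt0.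
- have e0 : 0 < X (crossing q) - q by rewrite subr_gt0.
  have /nbhs_ballP[e /= epos He] := Xcr _ e0.
  have : crossing q + e / 2 <= crossing q.
    apply: ub_le_sup; first by case: hs.
    have /= := He (crossing q + e / 2); rewrite /ball/= opprD addNKr normrN gtr0_norm ?divr_gt0//.
    have -> : e / 2 < e by rewrite ltr_pdivrMr// ltr_pMr// ltr1n.
    move=> /(_ isT); rewrite ltr_norml => /andP[_]; lra.
  lra.
- have e0 : 0 < q - X (crossing q) by rewrite subr_gt0.
  have /nbhs_ballP[e /= epos He] := Xcr _ e0.
  have [t /= qt tlt] := sup_adherent epos hs.
  have tle : t <= crossing q by apply: ub_le_sup => //; case: hs.
  have /= := He t; rewrite /ball/= ger0_norm ?subr_ge0//.
  have -> : crossing q - t < e by move: tlt; rewrite -/(crossing q); lra.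
  move=> /(_ isT); rewrite ltr_norml => /andP[]; lra.
Qed.

(** [crossing] is a generalized inverse of [X], insensitive to plateaus; the change of variables
    below rests on this equivalence. *)
Lemma le_crossing q t : levels q -> (t <= crossing q) = (q <= X t).
Proof.
move=> Dq; apply/idP/idP => [/Xn|qt]; first by rewrite crossingK.
by apply: ub_le_sup => //; case: (crossing_has_sup Dq).
Qed.

Lemma levels_measurable : measurable levels.
Proof.
apply: is_interval_measurable => p q [pw [t pt]] [qw [s qs]] r /andP[pr rq].
by split; [exact: le_trans rq qw|exists t; exact: lt_le_trans pt pr].
Qed.

(** [crossing] is nonincreasing in the level, so preimages of rays are intervals. *)
Lemma crossing_measurable : measurable_fun levels crossing.
Proof.
apply: (measurability (@RGenCInfty.G R)) => [|/= _ [_] [r] -> <-].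
  exact: RGenCInfty.measurableE.
apply: is_interval_measurable => p q [Dp] + [Dq] + u /andP[pu uq] /=.
rewrite !in_itv/= !andbT => _ rq.
have Du : levels u.
  case: (Dp) => _ [s ps]; case: (Dq) => qw _.
  by split; [exact: le_trans uq qw|exists s; exact: lt_le_trans ps pu].
split => //; rewrite le_crossing//.
by apply: (le_trans uq); rewrite -le_crossing//; move: rq; rewrite in_itv/= andbT.
Qed.

End LastCrossing.

(** * Work as the image of Lebesgue measure on levels *)

Section CumulativeIntegral.
Local Open Scope classical_set_scope.
Context {R : realType} (rho : R -> R) (w : R).
Local Notation mu := (@lebesgue_measure R).
Context (rho_meas : measurable_fun setT rho) (rho_ge0 : forall t, 0 <= rho t).
Context (rho_fin : forall t, (\int[mu]_(u in `]-oo, t]) (rho u)%:E < +oo)%E).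
Context (rho0 : exists a, forall t, t < a -> rho t = 0).

Let I t := (\int[mu]_(u in `]-oo, t]) (rho u)%:E)%E.
Definition leftover (t : R) : R := w - fine (I t).

Let mrho : measurable_fun setT (EFin \o rho).
Proof. exact/measurable_EFinP. Qed.

Let mrhoD D : measurable D -> measurable_fun D (fun t => (rho t)%:E).
Proof. by move=> mD; apply: measurable_funS mrho. Qed.

Let I_ge0 t : (0 <= I t)%E.
Proof. by apply: integral_ge0 => u _; rewrite lee_fin. Qed.

Let I_fin t : I t \is a fin_num.
Proof. by rewrite ge0_fin_numE//; exact: rho_fin. Qed.

Let I_split x y : x <= y -> (I y = I x + \int[mu]_(u in `]x, y]) (rho u)%:E)%E.
Proof.
move=> xy; rewrite /I (@itv_bndbnd_setU _ _ -oo%O (BRight x) (BRight y))//.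
apply: ge0_integral_setU => //.
- exact: measurable_funTS mrho.
- by move=> u _; rewrite lee_fin.
- apply/disj_set2P; rewrite -subset0 => z/=; rewrite !in_itv/= => -[zx /andP[xz _]].
  by rewrite ltNge zx in xz.
Qed.

Lemma leftover_nincr : {homo leftover : s t / s <= t >-> t <= s}.
Proof.
move=> s t st; rewrite lerD2l lerN2 fine_le// (I_split st) leeDl//.
by apply: integral_ge0 => u _; rewrite lee_fin.
Qed.

Lemma leftover_before a : (forall t, t < a -> rho t = 0) ->
  forall t, t < a -> leftover t = w.
Proof.
move=> rhoa t ta; rewrite /leftover /I.
rewrite integral0_eq ?subr0// => u /=; rewrite in_itv/= => ut.
by rewrite rhoa// (le_lt_trans ut).
Qed.

Lemma leftover_init : exists a, forall t, t < a -> leftover t = w.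
Proof. by have [a rhoa] := rho0; exists a; exact: leftover_before. Qed.

Lemma leftover_continuous : continuous leftover.
Proof.
move=> t0; apply/cvgrPdist_lt => e e0.
(* [rho] need not be integrable on the whole line, so it is cut off at [t0 + 1] before using
   absolute continuity of the integral; hence the 1 in [Num.min d 1]. *)
pose g := rho \_ `]-oo, (t0 + 1)].
have gi : mu.-integrable setT (EFin \o g).
  rewrite /g -restrict_EFin; apply/integrable_restrict => //=; rewrite setTI.
  apply/integrableP; split; first exact: mrhoD.
  under eq_integral do rewrite /= ger0_norm//.
  exact: rho_fin.
have [d [d0 Hd]] := integral_normr_continuous gi e0.
have key x y : x <= y -> y <= t0 + 1 -> y - x < d -> leftover x - leftover y < e.
  move=> xy yt dxy.
  have mu_xy : (mu `]x, y] < d%:E)%E.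
    rewrite lebesgue_measure_itv/= lte_fin; case: ifP => _; last by rewrite lte_fin.
    by rewrite -EFinD lte_fin.
  have := Hd _ (measurable_itv _) mu_xy.
  rewrite /Rintegral /leftover.
  have -> : (\int[mu]_(x0 in `]x, y]) (`|g x0|)%:E = \int[mu]_(u in `]x, y]) (rho u)%:E)%E.
    apply: eq_integral => u; rewrite inE/= in_itv/= => /andP[_ uy].
    by rewrite /g patchE ifT ?ger0_norm// inE/= in_itv/= (le_trans uy).
  have := I_split xy; set J := (\int[mu]_(u in `]x, y]) _)%E => IJ.
  have J0 : (0 <= J)%E by apply: integral_ge0 => u _; rewrite lee_fin.
  have Jf : J \is a fin_num.
    rewrite ge0_fin_numE// (le_lt_trans _ (rho_fin y))// -/(I y) IJ leeDr//.
  rewrite IJ (fineD (I_fin x) Jf) => HJ; lra.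
have m0 : 0 < Num.min d 1 by rewrite lt_min d0 ltr01.
apply/nbhs_ballP; exists (Num.min d 1) => //= t; rewrite /ball/= lt_min => /andP[td t1].
have [tt0|t0t] := leP t t0.
  have k : leftover t - leftover t0 < e.
    apply: key => //; first by rewrite lerDl.
    by move: td; rewrite ger0_norm// subr_ge0.
  by rewrite distrC ger0_norm// subr_ge0 leftover_nincr.
have k : leftover t0 - leftover t < e.
  apply: key; first exact: ltW.
  - by move: t1; rewrite ltr_norml => /andP[]; lra.
  - by move: td; rewrite ltr_norml => /andP[]; lra.
by rewrite ger0_norm// subr_ge0 leftover_nincr// ltW.
Qed.

(* The two measures below agree on the half-lines [`]-oo, x[]. *)
Let nu (A : set R) : \bar R := (\int[mu]_(t in A) (rho t)%:E)%E.

Let nu0 : nu set0 = 0%E. Proof. exact: integral_set0. Qed.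
Let nu_ge0 A : (0 <= nu A)%E.
Proof. by apply: integral_ge0 => u _; rewrite lee_fin. Qed.
Let nu_sigma_additive : semi_sigma_additive nu.
Proof.
move=> F mF tF mUF; rewrite /nu ge0_integral_bigcup//; last first.
- by move=> u _; rewrite lee_fin.
- exact: measurable_funTS mrho.
by apply: is_cvg_ereal_nneg_natsum => n _; exact: nu_ge0.
Qed.
HB.instance Definition _ := isMeasure.Build _ _ _ nu nu0 nu_ge0 nu_sigma_additive.

Let D := levels leftover w.
Let tau := crossing leftover.
Let mD : measurable D := levels_measurable leftover w.
Let mpre A : measurable A -> measurable (D `&` tau @^-1` A).
Proof. by move=> mA; apply: crossing_measurable => //; [exact: leftover_continuous|exact: leftover_nincr|exact: leftover_init]. Qed.

Let nu' (A : set R) : \bar R := mu (D `&` tau @^-1` A).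
Let nu'0 : nu' set0 = 0%E.
Proof. by rewrite /nu' preimage_set0 setI0 measure0. Qed.
Let nu'_ge0 A : (0 <= nu' A)%E. Proof. exact: measure_ge0. Qed.
Let nu'_sigma_additive : semi_sigma_additive nu'.
Proof.
move=> F mF tF mUF; rewrite /nu' preimage_bigcup setI_bigcupr.
apply: measure_semi_sigma_additive.
- by move=> n; exact: mpre.
- apply/trivIsetP => /= i j _ _ ij; rewrite setIACA -preimage_setI.
  by move/trivIsetP : tF => /(_ _ _ _ _ ij) ->//; rewrite preimage_set0 setI0.
- by rewrite -setI_bigcupr -preimage_bigcup; exact: mpre.
Qed.
HB.instance Definition _ := isMeasure.Build _ _ _ nu' nu'0 nu'_ge0 nu'_sigma_additive.

(** The levels crossed strictly before [x] form []leftover x, w]], whose length is the work done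
    before [x]. Both measures are finite on these rays, so agreement there extends to all Borel
    sets. *)
Lemma integral_rate_crossing (B : set R) : measurable B ->
  (\int[mu]_(t in B) (rho t)%:E)%E = mu (D `&` tau @^-1` B).
Proof.
rewrite -[LHS]/(nu B) -[RHS]/(nu' B); move: B.
pose G := [set A : set R | exists x, A = `]-oo, x[%classic].
apply: (measure_unique G (fun n => `]-oo, n%:R[%classic)) => //.
- exact: RGenInftyO.measurableE.
- move=> _ _ [x ->] [y ->]; exists (Num.min x y); apply/seteqP; split => z /=;
    rewrite !in_itv/= lt_min; first by case=> -> ->.
  by move=> /andP[].
- by move=> n; exists n%:R.
- apply/seteqP; split => // x _; exists (Num.truncn `|x|).+1 => //=.
  by rewrite in_itv/= (le_lt_trans (ler_norm _))// truncnS_gt.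
- move=> _ [x ->]; rewrite -[LHS]/(nu _) -[RHS]/(mu (D `&` tau @^-1` `]-oo, x[)).
  have -> : nu `]-oo, x[ = I x.
    by rewrite /nu /I integral_itv_bndo_bndc//; exact: measurable_funTS mrho.
  have -> : D `&` tau @^-1` `]-oo, x[ = `]leftover x, w]%classic.
    have le_cr q : D q -> (x <= tau q) = (q <= leftover x).
      apply: le_crossing; [exact: leftover_continuous|exact: leftover_nincr|exact: leftover_init].
    apply/seteqP; split => q /=; rewrite !in_itv/=.
      by move=> [Dq]; rewrite ltNge le_cr// -ltNge => ->/=; case: Dq.
    move=> /andP[Xq qw]; have Dq : D q by split => //; exists x.
    by split => //; rewrite ltNge le_cr// -ltNge.
  rewrite lebesgue_measure_itv/= lte_fin -{1}[w](subr0) /leftover ltrD2l ltrN2.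
  rewrite -[I x in LHS]fineK//.
  have := fine_ge0 (I_ge0 x); rewrite le_eqVlt => /orP[/eqP <-|->].
    by rewrite ltxx.
  by rewrite -EFinD subKr.
- move=> n; apply: le_lt_trans (rho_fin n%:R).
  rewrite -[X in (X <= _)%E]/(nu `]-oo, n%:R[); apply: ge0_subset_integral => //.
  + exact: measurable_funTS mrho.
  + by move=> u _; rewrite lee_fin.
  + by move=> z /=; rewrite !in_itv/=; apply: ltW.
Qed.

(** [F] takes finitely many values; on each of its fibres the weight is constant and
    [integral_rate_crossing] applies. *)
Lemma integral_comp_crossing (F : R -> nat) (M : nat) (h : nat -> R) :
  measurable_fun setT F -> (forall t, (F t <= M)%N) -> (forall v, 0 <= h v) ->
  (\int[mu]_t (h (F t) * rho t)%:E = \int[mu]_(q in levels leftover w) (h (F (crossing leftover q)))%:E)%E.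
Proof.
move=> mF FM h_ge0.
have hE t : h (F t) = \sum_(v < M.+1) h v * (F t == v)%:R.
  rewrite (bigD1 (Ordinal (FM t : (F t < M.+1)%N)))//= eqxx mulr1 big1 ?addr0// => v.
  by rewrite -val_eqE/= eq_sym => /negPf ->; rewrite mulr0.
have mFv v : measurable (F @^-1` [set v]) by rewrite -[X in measurable X]setTI; exact: mF.
transitivity (\sum_(v < M.+1) ((h v)%:E * \int[mu]_(t in F @^-1` [set (v : nat)]) (rho t)%:E))%E.
  transitivity (\int[mu]_t \sum_(v < M.+1) ((h v)%:E * ((fun t => (rho t)%:E) \_ (F @^-1` [set (v : nat)])) t))%E.
    apply: eq_integral => t _; rewrite hE mulr_suml -sumEFin; apply: eq_bigr => v _.
    rewrite -mulrA EFinM; congr (_ * _)%E; rewrite patchE.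
    case: eqP => Ftv; rewrite ?mul1r ?mul0r; first by rewrite ifT// inE.
    by rewrite ifF//; apply/negP; rewrite inE.
  have mr v : measurable_fun setT ((fun t => (rho t)%:E) \_ (F @^-1` [set v])).
    by apply/(measurable_restrictT _ _).1 => //; exact: mrhoD.
  have r0 v t : (0 <= ((fun t => (rho t)%:E) \_ (F @^-1` [set v])) t)%E.
    by apply: erestrict_ge0 => u _; rewrite lee_fin.
  rewrite ge0_integral_sum//; last 2 first.
  - by move=> v; apply: measurable_funeM; exact: mr.
  - by move=> v t _; rewrite mule_ge0// lee_fin.
  apply: eq_bigr => v _; rewrite ge0_integralZl//; last by rewrite lee_fin.
    by rewrite -integral_mkcond.
  exact: mr.
transitivity (\int[mu]_(q in D) \sum_(v < M.+1) ((h v)%:E * (\1_(D `&` tau @^-1` (F @^-1` [set (v : nat)])) q)%:E))%E; last first.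
  apply: eq_integral => q; rewrite inE => Dq; rewrite hE -sumEFin; apply: eq_bigr => v _.
  rewrite EFinM; congr (_ * _%:E)%E; rewrite indicE; congr ((nat_of_bool _)%:R).
  by apply/idP/eqP; rewrite inE; [case|].
have mi v : measurable_fun D (fun q => (\1_(D `&` tau @^-1` (F @^-1` [set v])) q)%:E : \bar R).
  by apply/measurable_EFinP; apply: measurable_indic; exact: mpre.
rewrite ge0_integral_sum//; last 2 first.
- by move=> v; apply: measurable_funeM; exact: mi.
- by move=> v t _; rewrite mule_ge0// lee_fin.
apply: eq_bigr => v _; rewrite ge0_integralZl//; last by rewrite lee_fin.
  rewrite integral_rate_crossing//; congr (_ * _)%E.
  rewrite integral_indic//; last exact: mpre.
  by congr (mu _); apply/seteqP; split => q /=; tauto.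
exact: mi.
Qed.

End CumulativeIntegral.

(** * Schedules *)

Section FeasibleSchedule.
Local Open Scope classical_set_scope.
Context {R : realType} {m N : nat} (a w : 'I_N -> R) (S : schedule R m N).
Local Notation mu := (@lebesgue_measure R).
Context (S_feas : feasible a S).

Lemma rate_ge0 j t : 0 <= rate S j t.
Proof. by case: S_feas => S0 _ _ _ _; apply: sumr_ge0 => k _; case: ifP. Qed.

Lemma rate_measurable j : measurable_fun setT (rate S j).
Proof.
case: S_feas => _ Sm Am _ _; apply: measurable_sum => k.
apply: measurable_fun_ifT => //; apply: (measurable_fun_bool true).
rewrite (_ : _ @^-1` _ = [set t | assign S k t = Some j]); first by rewrite setTI.
by apply/seteqP; split => t /=; [move/eqP|move=> ->; rewrite eqxx].
Qed.

Lemma rate_eq0 j t : t < a j -> rate S j t = 0.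
Proof.
case: S_feas => _ _ _ _ Sa ta; apply: big1 => k _; case: eqP => // /Sa.
by rewrite leNgt ta.
Qed.

Lemma rate_unassigned j t : (forall k, assign S k t <> Some j) -> rate S j t = 0.
Proof. by move=> nj; apply: big1 => k _; case: eqP => // /nj. Qed.

Lemma rate_assigned k j t : assign S k t = Some j -> rate S j t = speed S k t.
Proof.
case: S_feas => _ _ _ inj _ kj; rewrite /rate (bigD1 k)//= kj eqxx big1 ?addr0// => k' k'k.
case: eqP => // k'j; have := inj _ _ _ _ k'j kj; by move/eqP; rewrite (negPf k'k).
Qed.

Lemma runningP j t : reflect (exists k, assign S k t = Some j) (j \in running S t).
Proof.
by rewrite inE; apply: (iffP existsP) => -[k]; [move/eqP|move=> /eqP]; exists k.
Qed.

Lemma running_measurable j : measurable_fun setT (fun t => j \in running S t).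
Proof.
case: S_feas => _ _ Am _ _; apply: (measurable_fun_bool true); rewrite setTI.
rewrite (_ : _ @^-1` _ = \bigcup_(k in [set: 'I_m]) [set t | assign S k t = Some j]).
  by apply: fin_bigcup_measurable => //; exact: finite_finset.
apply/seteqP; split => t /=.
  by move=> /runningP[k kj]; exists k.
by move=> [k _ kj]; apply/runningP; exists k.
Qed.

(** Serves both schedules: [f = 0] for the algorithm, whose speeds are bounded, and [C = 1] with [f]
    the power for the other one. *)
Lemma work_lty (C : R) (f : R -> \bar R) :
  measurable_fun setT f -> (forall t, 0 <= f t)%E -> (\int[mu]_t f t < +oo)%E -> 0 <= C ->
  (forall j t, (rate S j t)%:E <= C%:E + f t)%E ->
  forall j t, (work S j t < +oo)%E.
Proof.
move=> mf f0 fi C0 rC j t.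
have mr : measurable_fun setT (fun t => (rate S j t)%:E).
  by apply/measurable_EFinP; exact: rate_measurable.
(* The rate vanishes before the release, so the constant is integrated only over the bounded
   interval from [a j] to [t]. *)
pose c u := (C%:E * (\1_(`[a j, t]) u)%:E)%E.
have mc : measurable_fun setT c.
  by apply: measurable_funeM; apply/measurable_EFinP; exact: measurable_indic.
have c0 u : (0 <= c u)%E by rewrite /c mule_ge0// lee_fin.
have lei : (work S j t <= \int[mu]_u (c u + f u))%E.
  rewrite /work; apply: (@le_trans _ _ (\int[mu]_(u in `]-oo, t]) (c u + f u))%E); last first.
    apply: ge0_subset_integral => //; first by apply: emeasurable_funD.
    by move=> u _; rewrite adde_ge0.
  apply: ge0_le_integral => //.
  - by move=> u _; rewrite lee_fin rate_ge0.
  - exact: measurable_funTS mr.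
  - by apply: measurable_funTS; apply: emeasurable_funD.
  - move=> u /=; rewrite in_itv/= => ut; have [ua|au] := ltP u (a j).
      by rewrite rate_eq0// adde_ge0.
    by apply: (le_trans (rC j u)); rewrite leeD2r// /c indicE mem_set ?mule1//= in_itv/= au.
apply: le_lt_trans lei _; rewrite ge0_integralD// lte_add_pinfty//.
rewrite ge0_integralZl//.
  rewrite integral_indic// setIT -[X in (_ * X)%E]/(mu `[a j, t]) lebesgue_measure_itv/=.
  by case: ifP => _; rewrite ?mule0// -EFinD -EFinM ltry.
by apply/measurable_EFinP; exact: measurable_indic.
Qed.

Section FiniteWork.
Context (S_fin : forall j t, (work S j t < +oo)%E).

Definition residual (j : 'I_N) : R -> R := leftover (rate S j) (w j).

Lemma residual_continuous j : continuous (residual j).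
Proof. by apply: leftover_continuous; [exact: rate_measurable|exact: rate_ge0|exact: S_fin]. Qed.

Lemma residual_nincr j : {homo residual j : s t / s <= t >-> t <= s}.
Proof. by apply: leftover_nincr; [exact: rate_measurable|exact: rate_ge0|exact: S_fin]. Qed.

Lemma residual_before j t : t < a j -> residual j t = w j.
Proof. by move=> ta; apply: leftover_before ta; exact: rate_eq0. Qed.

Lemma residual_init j : exists b, forall t, t < b -> residual j t = w j.
Proof. by exists (a j); exact: residual_before. Qed.

Lemma work_fin_num j t : work S j t \is a fin_num.
Proof. by rewrite ge0_fin_numE//; apply: integral_ge0 => u _; rewrite lee_fin rate_ge0. Qed.

Lemma remainingE j t : remaining w S j t = (residual j t)%:E.
Proof. by rewrite /remaining /residual /leftover EFinB fineK ?work_fin_num. Qed.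

Lemma aliveE j t : alive a w S j t = (a j <= t) && (0 < residual j t).
Proof.
rewrite /alive; congr (_ && _).
by rewrite -(fineK (work_fin_num j t)) lte_fin -subr_gt0.
Qed.

Lemma residual_measurable j : measurable_fun setT (residual j).
Proof. exact: nonincreasing_measurable (@residual_nincr j). Qed.

Lemma alive_measurable j : measurable_fun setT (alive a w S j).
Proof.
rewrite (_ : alive a w S j = fun t => (a j <= t) && (0 < residual j t)); last first.
  by apply/funext => t; rewrite aliveE.
apply: measurable_and; first exact: measurable_fun_ler.
by apply: measurable_fun_ltr => //; exact: residual_measurable.
Qed.

End FiniteWork.
End FeasibleSchedule.

Section Priority.
Context {R : realType} {m N : nat} (a w : 'I_N -> R) (S : schedule R m N).

(* Ties are broken in favour of the running jobs: this makes the jobs served by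
   SRPT the lowest ones, whatever its tie-breaking rule. *)
Definition priority (t : R) (j : 'I_N) : R *l (bool *l 'I_N) :=
  (residual w S j t, (j \notin running S t, j)).

Lemma priority_inj t : injective (priority t).
Proof. by move=> i j [_ _]. Qed.

Definition job_rank (j : 'I_N) (t : R) : nat := rank (priority t) (alive_set a w S t) j.

(** Finishing is relative to a level: [finish_time j q] is the last moment at which at least [q] of
    job [j] is left. *)
Definition finishes (j : 'I_N) : set R := levels (residual w S j) (w j).
Definition finish_time (j : 'I_N) (q : R) : R := crossing (residual w S j) q.

Context (S_feas : feasible a S) (S_fin : forall j t, (work S j t < +oo)%E).

Let fin_le j q t : finishes j q -> (t <= finish_time j q) = (q <= residual w S j t).
Proof.
apply: le_crossing.
- exact: residual_continuous S_feas S_fin j.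
- exact: residual_nincr S_feas S_fin j.
- exact: residual_init S_feas j.
Qed.

Let finK j q : finishes j q -> residual w S j (finish_time j q) = q.
Proof.
apply: crossingK.
- exact: residual_continuous S_feas S_fin j.
- exact: residual_nincr S_feas S_fin j.
- exact: residual_init S_feas j.
Qed.

(** The residual at the crossing is exactly [q], and it stays at [w j] until the release, so no
    level is crossed earlier. *)
Lemma alive_finish_time j q : finishes j q -> alive a w S j (finish_time j q) = (0 < q).
Proof.
move=> Dq; rewrite (aliveE _ S_feas)// finK//; case: (0 < q) => //=; rewrite ?andbF// andbT.
rewrite leNgt; apply/negP => lta.
have [s /andP[ts sa]] : exists s, finish_time j q < s < a j.
  by exists ((finish_time j q + a j) / 2); rewrite !midf_lt.
have : s <= finish_time j q by rewrite fin_le// (residual_before _ S_feas)//; case: Dq.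
by rewrite leNgt ts.
Qed.

End Priority.

(** * Comparison of the two schedules at a fixed level *)

Section LevelInequality.
Context {R : realType} {m N : nat} (a w : 'I_N -> R) (S1 S2 : schedule R m N).
Context (S1_feas : feasible a S1) (S1_fin : forall j t, (work S1 j t < +oo)%E).
Context (S2_feas : feasible a S2) (S2_fin : forall j t, (work S2 j t < +oo)%E).
Context (q : R) (q_gt0 : 0 < q).

Let sch (b : bool) := if b then S1 else S2.
Let sch_feas b : feasible a (sch b). Proof. by case: b. Qed.
Let sch_fin b j t : (work (sch b) j t < +oo)%E. Proof. by case: b. Qed.
Let X b j := residual w (sch b) j.
Let tau (e : bool * 'I_N) := finish_time w (sch e.1) e.2 q.
(** Unreleased jobs count in both schedules, so the two counts start equal and releases are not
    events. *)
Let U : {set bool * 'I_N} := [set e | q <= w e.2].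
Let E : {set bool * 'I_N} := [set e | `[< finishes w (sch e.1) e.2 q >]].
(** The last two components repeat the tie-breaking of [priority], so that simultaneous crossings
    within one schedule come in the order used by [job_rank]. *)
Let key (e : bool * 'I_N) : R *l (bool *l (bool *l 'I_N)) :=
  (tau e, (e.1, (e.2 \notin running (sch e.1) (tau e), e.2))).
Let nb e := U :\: [set e' in E | (key e' < key e)%O].

Let inE_E e : (e \in E) = `[< finishes w (sch e.1) e.2 q >].
Proof. by rewrite inE. Qed.

Let tau_le e t : e \in E -> (t <= tau e) = (q <= X e.1 e.2 t).
Proof.
rewrite inE_E => /asboolP; apply: le_crossing.
- exact: residual_continuous (sch_feas _) (sch_fin _) _.
- exact: residual_nincr (sch_feas _) (sch_fin _) _.
- exact: residual_init (sch_feas _) _.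
Qed.

Let tauK e : e \in E -> X e.1 e.2 (tau e) = q.
Proof.
rewrite inE_E => /asboolP; apply: crossingK.
- exact: residual_continuous (sch_feas _) (sch_fin _) _.
- exact: residual_nincr (sch_feas _) (sch_fin _) _.
- exact: residual_init (sch_feas _) _.
Qed.

Let X_le b j t : X b j t <= w j.
Proof.
have mt : Num.min t (a j - 1) <= t by rewrite ge_min lexx.
apply: le_trans (@residual_nincr _ _ _ a w _ (sch_feas b) (sch_fin b) j _ _ mt) _.
by rewrite (residual_before _ (sch_feas b))// gt_min orbC ltrBlDr ltrDl ltr01.
Qed.

Let in_nb e e' : (e' \in nb e) = (q <= w e'.2) && ((e' \in E) ==> (key e <= key e')%O).
Proof. by rewrite finset.in_setD /U !finset.in_set negb_and -leNgt implybE andbC. Qed.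

Let nb_sub e e' : e \in E -> e' \in nb e -> q <= X e'.1 e'.2 (tau e).
Proof.
move=> eE; rewrite in_nb => /andP[qw]; case: (boolP (e' \in E)) => [e'E|nE _].
  by rewrite -tau_le//= /key lexi_pair => /andP[].
rewrite leNgt; apply/negP => Xq; move: nE; rewrite inE_E/= => /asboolP; apply.
by split => //; exists (tau e).
Qed.

Let nb_unreleased e e' : tau e < a e'.2 -> q <= w e'.2 -> e' \in nb e.
Proof.
move=> ta qw; rewrite in_nb qw/=; apply/implyP => e'E.
suff : tau e < tau e' by rewrite /key lexi_pair; case: ltgtP.
have [s /andP[ts sa]] : exists s, tau e < s < a e'.2.
  by exists ((tau e + a e'.2) / 2); rewrite !midf_lt.
by apply: (lt_le_trans ts); rewrite tau_le// /X (residual_before _ (sch_feas _)).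
Qed.

Let nb_gt e e' : q < X e'.1 e'.2 (tau e) -> e' \in nb e.
Proof.
move=> qX; rewrite in_nb (le_trans (ltW qX) (X_le _ _ _))/=; apply/implyP => e'E.
have : tau e <= tau e' by rewrite tau_le// ltW.
rewrite le_eqVlt => /orP[/eqP tt|]; last by rewrite /key lexi_pair; case: ltgtP.
by move: qX; rewrite tt tauK// ltxx.
Qed.

(** A residual above [q] means that the job is uncrossed. If the residual equals [q], the job does
    not cross, crosses later, or crosses at the same time and is placed no earlier by the
    tie-breaking. *)
Let nb_priority e j : e \in E ->
  (priority w (sch e.1) (tau e) e.2 <= priority w (sch e.1) (tau e) j)%O ->
  (e.1, j) \in nb e.
Proof.
move=> eE; rewrite /priority lexi_pair /= -/(X e.1 e.2) -/(X e.1 j) tauK// => /andP[].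
rewrite le_eqVlt => /orP[/eqP qX|qX _]; last exact: nb_gt.
rewrite -qX lexx/= => pr; rewrite in_nb/= {1}qX X_le/=; apply/implyP => jE.
have : tau e <= tau (e.1, j) by rewrite tau_le//= -qX.
rewrite /key lexi_pair => tt; rewrite tt/=; apply/implyP => tt'.
have tE : tau (e.1, j) = tau e by apply: le_anti; rewrite tt tt'.
by rewrite tE lexi_pair lexx.
Qed.

Let u e : nat := #|[set i | (q <= w i) && (tau e < a i)]|.
Let cnt b e := #|[set e' in nb e | e'.1 == b]|.

Let cntE b e : cnt b e = #|[set i | (b, i) \in nb e]|.
Proof.
transitivity #|[set (b, i) | i in [set i | (b, i) \in nb e]]|; last first.
  by rewrite card_imset// => i j [].
apply: eq_card => -[b' i]; rewrite finset.in_set /=; apply/idP/imsetP => [|[j]].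
  by move=> /andP[+ /eqP bb]; rewrite bb => inb; exists i => //; rewrite finset.in_set.
by rewrite finset.in_set => ? [-> ->]; rewrite eqxx andbT.
Qed.

Let cnt_upper b e : e \in E -> (cnt b e <= nalive a w (sch b) (tau e) + u e)%N.
Proof.
move=> eE; rewrite cntE /nalive /u; apply: leq_trans (leq_card_setU _ _).
apply: subset_leq_card; apply/fintype.subsetP => i; rewrite finset.in_set => inb.
rewrite finset.in_setU !finset.in_set (aliveE _ (sch_feas b))//.
have qX := nb_sub eE inb; rewrite (lt_le_trans q_gt0 qX) andbT/=.
by case: leP; rewrite ?(le_trans qX (X_le _ _ _)).
Qed.

(** The jobs counted by the rank are released, those counted by [u e] are not, and all of them are
    uncrossed. The same [u e] occurs in [cnt_upper], so it cancels in the balance. *)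
Let cnt_lower e : e \in E -> (job_rank a w (sch e.1) e.2 (tau e) + u e <= cnt e.1 e)%N.
Proof.
move=> eE; rewrite cntE /job_rank /rank /u -cardsUI [X in (_ + X)%N](_ : _ = 0%N) ?addn0; last first.
  apply/eqP; rewrite cards_eq0; apply/eqP/setP => i; rewrite !inE /alive.
  by case: (leP (a i) (tau e)) => _; rewrite ?andbF.
apply: subset_leq_card; apply/fintype.subsetP => i iU.
suff : (e.1, i) \in nb e by move=> inb; rewrite finset.in_set.
case/finset.setUP: iU => [/setIdP[_]|iU]; first exact: nb_priority.
have /andP[qw ta] : (q <= w i) && (tau e < a i) by rewrite inE in iU.
exact: nb_unreleased.
Qed.

Context (h : nat -> R) (h0 : h 0%N = 0) (h_ndecr : {homo h : m n / (m <= n)%N >-> m <= n}).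

(** This is [telescoping_le] with initial balance 0: [cnt_lower] for the schedule that crosses and
    [cnt_upper] for the other one bound the arguments of the monotone [h]. *)
Lemma level_inequality :
  \sum_(j | `[< finishes w S1 j q >])
     h (job_rank a w S1 j (finish_time w S1 j q) - nalive a w S2 (finish_time w S1 j q))
  <= \sum_(j | `[< finishes w S2 j q >])
     h (nalive a w S1 (finish_time w S2 j q) - (job_rank a w S2 j (finish_time w S2 j q)).-1).
Proof.
have h_ge0 v : 0 <= h v by rewrite -h0 h_ndecr.
have EU : E \subset U.
  by apply/fintype.subsetP => e; rewrite !finset.in_set => /asboolP[].
have kI : {in E &, injective key}.
  by move=> [b i] [b' i'] _ _ [_ /= -> _ ->].
have := @telescoping_le _ _ _ _ h h0 h_ge0 fst key U E EU kI.
have cT e : #|[set e' in nb e | e'.1]| = cnt true e.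
  by apply: eq_card => x; rewrite !inE eqb_id.
have cF e : #|[set e' in nb e | ~~ e'.1]| = cnt false e.
  by apply: eq_card => x; rewrite !inE eqbF_neg.
rewrite -[X in \sum_(v < X.+1) _]/(#|[set e in U | e.1]| - #|[set e in U | ~~ e.1]|)%N.
have -> : (#|[set e in U | e.1]| - #|[set e in U | ~~ e.1]|)%N = 0%N.
  rewrite -(@card_in_imset _ _ (fun e => (~~ e.1, e.2)) (mem [set e in U | e.1])); last first.
    by move=> [b i] [b' i'] _ _ [/negb_inj -> ->].
  apply/eqP; rewrite subn_eq0; apply: subset_leq_card; apply/fintype.subsetP => e /imsetP[e'].
  by rewrite inE => /andP[]; rewrite !inE => ? ? ->/=; rewrite negbK; apply/andP.
rewrite big_ord1 h0 add0r.
under eq_bigr do rewrite cT cF; under [leRHS]eq_bigr do rewrite cT cF.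
have sumE (b : bool) (G : bool * 'I_N -> R) :
    \sum_(e in E | e.1 == b) G e = \sum_(j | `[< finishes w (sch b) j q >]) G (b, j).
  rewrite (reindex_onto (pair b) snd); last by move=> [b' i] /andP[_ /eqP/= ->].
  by apply: eq_bigl => j; rewrite inE_E/= !eqxx !andbT.
under eq_bigl do rewrite -[_.1]eqb_id; under [leRHS]eq_bigl do rewrite -eqbF_neg.
rewrite !sumE /= => le_tel; apply: le_trans (le_trans le_tel _).
- apply: ler_sum => j fj; apply: h_ndecr.
  have eE : (true, j) \in E by rewrite inE_E.
  have := cnt_lower eE; have := cnt_upper false eE; rewrite /tau/=; lia.
- apply: ler_sum => j fj; apply: h_ndecr.
  have eE : (false, j) \in E by rewrite inE_E.
  have := cnt_lower eE; have := cnt_upper true eE; rewrite /tau/=.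
  (* The rank counts the crossing job itself, so [.-1] does not truncate. *)
  have : (0 < job_rank a w S2 j (finish_time w S2 j q))%N.
    by apply: rank_gt0; rewrite inE alive_finish_time//; apply/asboolP.
  lia.
Qed.

End LevelInequality.

(** * The potential inequality *)

Section CountMeasurable.
Context {d : measure_display} {T : measurableType d}.

Lemma measurable_sumn (I : Type) (s : seq I) (F : I -> T -> nat) :
  (forall i, measurable_fun setT (F i)) ->
  measurable_fun setT (fun t => \sum_(i <- s) F i t)%N.
Proof.
move=> mF; elim: s => [|i s IH].
  by under eq_fun do rewrite big_nil; exact: measurable_cst.
under eq_fun do rewrite big_cons.
exact: measurable_fun_addn.
Qed.

Lemma measurable_bool2 (op : bool -> bool -> bool) (f g : T -> bool) :
  measurable_fun setT f -> measurable_fun setT g ->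
  measurable_fun setT (fun t => op (f t) (g t)).
Proof.
move=> mf mg.
rewrite (_ : (fun t => _) = fun t => if f t then (if g t then op true true else op true false)
  else (if g t then op false true else op false false)); last first.
  by apply/funext => t; case: (f t); case: (g t).
by do 3 ?[apply: measurable_fun_ifT => //].
Qed.

Lemma measurable_card (I : finType) (P : I -> T -> bool) :
  (forall i, measurable_fun setT (P i)) ->
  measurable_fun setT (fun t => #|[set i | P i t]|).
Proof.
move=> mP.
rewrite (_ : (fun t => _) = fun t => (\sum_(i : I) (if P i t then 1 else 0))%N); last first.
  by apply/funext => t; rewrite -sum1_card big_mkcond; apply: eq_bigr => i _; rewrite inE.
by apply: measurable_sumn => i; apply: measurable_fun_ifT.
Qed.

End CountMeasurable.

Section ScheduleMeasurable.
Context {R : realType} {m N : nat} (a w : 'I_N -> R) (S : schedule R m N).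
Context (S_feas : feasible a S) (S_fin : forall j t, (work S j t < +oo)%E).

Lemma nalive_measurable : measurable_fun setT (nalive a w S).
Proof. by apply: measurable_card => j; exact: alive_measurable. Qed.

Lemma job_rank_measurable j : measurable_fun setT (job_rank a w S j).
Proof.
apply: measurable_card => i.
have mX k : measurable_fun setT (residual w S k) by exact: residual_measurable S_feas S_fin k.
have mr k : measurable_fun setT (fun t => k \notin running S t).
  by apply: measurable_neg; exact: running_measurable S_feas k.
rewrite (_ : (fun t => _) = fun t => alive a w S i t &&
  ((residual w S j t <= residual w S i t) &&
   ((residual w S i t <= residual w S j t) ==>
    (((j \notin running S t) <= (i \notin running S t))%O &&
     (((i \notin running S t) <= (j \notin running S t))%O ==> (j <= i)%O))))); last first.
  by apply/funext => t; rewrite inE /priority !lexi_pair.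
apply: measurable_bool2; first exact: alive_measurable.
apply: measurable_bool2; first exact: measurable_fun_ler.
apply: measurable_bool2; first exact: measurable_fun_ler.
exact: (measurable_bool2 (fun b b' => (b <= b')%O && ((b' <= b)%O ==> (j <= i)%O))).
Qed.

End ScheduleMeasurable.

Section PotentialInequality.
Context {R : realType} {m N : nat} (a w : 'I_N -> R) (S1 S2 : schedule R m N).
Local Notation mu := (@lebesgue_measure R).
Context (S1_feas : feasible a S1) (S1_fin : forall j t, (work S1 j t < +oo)%E).
Context (S2_feas : feasible a S2) (S2_fin : forall j t, (work S2 j t < +oo)%E).
Context (S2_done : forall j, exists t, residual w S2 j t <= 0).
Context (h : nat -> R) (h0 : h 0%N = 0) (h_ndecr : {homo h : m n / (m <= n)%N >-> m <= n}).
Context (k : R) (k_ge0 : 0 <= k).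

Definition descent (j : 'I_N) (t : R) : R :=
  if alive a w S1 j t then h (job_rank a w S1 j t - nalive a w S2 t) + k else 0.

Definition ascent (j : 'I_N) (t : R) : R :=
  if alive a w S2 j t then h (nalive a w S1 t - (job_rank a w S2 j t).-1) + k else 0.

Let h_ge0 v : 0 <= h v. Proof. by rewrite -h0 h_ndecr. Qed.

(** [descent] and [ascent] become [wt] of bounded natural numbers, with 0 reserved for a job that is
    not alive, to fit [integral_comp_crossing]. *)
Let wt (v : nat) : R := if v is v'.+1 then h v' + k else 0.
Let wt_ge0 v : 0 <= wt v. Proof. by case: v => // v; rewrite addr_ge0. Qed.

Let F1 j t : nat := if alive a w S1 j t then (job_rank a w S1 j t - nalive a w S2 t).+1 else 0%N.
Let F2 j t : nat := if alive a w S2 j t then (nalive a w S1 t - (job_rank a w S2 j t).-1).+1 else 0%N.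

Let descentE j t : descent j t = wt (F1 j t).
Proof. by rewrite /descent /F1; case: ifP. Qed.
Let ascentE j t : ascent j t = wt (F2 j t).
Proof. by rewrite /ascent /F2; case: ifP. Qed.

Lemma descent_ge0 j t : 0 <= descent j t. Proof. by rewrite descentE. Qed.
Lemma ascent_ge0 j t : 0 <= ascent j t. Proof. by rewrite ascentE. Qed.

Let measurable_S (T : R -> nat) : measurable_fun setT T -> measurable_fun setT (fun t => (T t).+1).
Proof.
move=> mT; under eq_fun do rewrite -addn1; exact: measurable_fun_addn.
Qed.

Let F1_meas j : measurable_fun setT (F1 j).
Proof.
apply: measurable_fun_ifT => //; first exact: alive_measurable.
apply: measurable_S; apply: measurable_fun_subn; first exact: job_rank_measurable.
exact: nalive_measurable.
Qed.

Let F2_meas j : measurable_fun setT (F2 j).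
Proof.
apply: measurable_fun_ifT => //; first exact: alive_measurable.
apply: measurable_S; apply: measurable_fun_subn; first exact: nalive_measurable.
under eq_fun do rewrite -subn1; apply: measurable_fun_subn => //.
exact: job_rank_measurable.
Qed.

Let wt_meas : measurable_fun setT wt.
Proof. by []. Qed.

Lemma descent_measurable j : measurable_fun setT (descent j).
Proof.
rewrite (_ : descent j = wt \o F1 j); last by apply/funext => t; rewrite descentE.
exact: measurableT_comp.
Qed.

Lemma ascent_measurable j : measurable_fun setT (ascent j).
Proof.
rewrite (_ : ascent j = wt \o F2 j); last by apply/funext => t; rewrite ascentE.
exact: measurableT_comp.
Qed.

Let nalive_le (S : schedule R m N) t : (nalive a w S t <= N)%N.
Proof. by rewrite -[X in (_ <= X)%N]card_ord max_card. Qed.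

Let job_rank_le (S : schedule R m N) j t : (job_rank a w S j t <= N)%N.
Proof. by rewrite -[X in (_ <= X)%N]card_ord max_card. Qed.

Let F1_le j t : (F1 j t <= N.+1)%N.
Proof. by rewrite /F1; case: ifP => // _; have := job_rank_le S1 j t; lia. Qed.
Let F2_le j t : (F2 j t <= N.+1)%N.
Proof. by rewrite /F2; case: ifP => // _; have := nalive_le S1 t; lia. Qed.

Let level_le q :
  \sum_j (if `[< finishes w S1 j q >] then wt (F1 j (finish_time w S1 j q)) else 0)
  <= \sum_j (if `[< finishes w S2 j q >] then wt (F2 j (finish_time w S2 j q)) else 0).
Proof.
have [q0|q0] := leP q 0.
  rewrite big1 => [|j _]; first by apply: sumr_ge0 => j _; case: ifP.
  case: asboolP => // Dq; rewrite /F1 (alive_finish_time S1_feas)//.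
  by rewrite ltNge q0.
rewrite -!big_mkcond/=.
under eq_bigr => j /asboolP Dq do rewrite /F1 (alive_finish_time S1_feas S1_fin Dq) q0 /=.
under [leRHS]eq_bigr => j /asboolP Dq do rewrite /F2 (alive_finish_time S2_feas S2_fin Dq) q0 /=.
rewrite !big_split/=; apply: lerD; first exact: level_inequality.
(* For the constant [k]: [S2] completes every job, so each job of size at least [q] crosses [q] in
   [S2], and [S2] has at least as many crossings as [S1]. *)
rewrite big_mkcond [leRHS]big_mkcond/=; apply: ler_sum => j _.
case: asboolP => [[qw _]|_]; last by case: ifP.
case: asboolP => // -[]; split => //.
by have [t t0] := S2_done j; exists t; exact: le_lt_trans t0 q0.
Qed.

Let integral_levels (S : schedule R m N) (F : 'I_N -> R -> nat) :
  feasible a S -> (forall j t, (work S j t < +oo)%E) ->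
  (forall j, measurable_fun setT (F j)) -> (forall j t, (F j t <= N.+1)%N) ->
  (forall j, measurable_fun setT (fun q =>
    (if `[< finishes w S j q >] then wt (F j (finish_time w S j q)) else 0)%:E : \bar R)) /\
  (\int[mu]_t (\sum_j wt (F j t) * rate S j t)%:E =
   \int[mu]_q (\sum_j if `[< finishes w S j q >] then wt (F j (finish_time w S j q)) else 0)%:E)%E.
Proof.
move=> S_feas S_fin mF F_le.
have Xc j := @residual_continuous _ _ _ a w S S_feas S_fin j.
have Xn j := @residual_nincr _ _ _ a w S S_feas S_fin j.
have Xi j := @residual_init _ _ _ a w S S_feas j.
have mD j : measurable (finishes w S j) by exact: levels_measurable.
have patchE_ j : (fun q => (if `[< finishes w S j q >] then wt (F j (finish_time w S j q)) else 0)%:E) =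
    ((fun q => (wt (F j (finish_time w S j q)))%:E) \_ (finishes w S j))%classic :> (R -> \bar R).
  apply/funext => q; rewrite patchE; case: asboolP => fq; first by rewrite ifT// inE.
  by rewrite ifF//; apply/negbTE/negP; rewrite inE.
have mif j : measurable_fun setT (fun q =>
    (if `[< finishes w S j q >] then wt (F j (finish_time w S j q)) else 0)%:E : \bar R).
  rewrite patchE_; apply/(measurable_restrictT _ (mD j)).
  apply/measurable_EFinP; apply: (measurableT_comp (f := wt)) => //.
  apply: (measurableT_comp (mF j)); exact: crossing_measurable.
split => //.
have mwF j : measurable_fun setT (fun t => wt (F j t)).
  exact: (measurableT_comp wt_meas (mF j)).
have mrate j : measurable_fun setT (rate S j) by exact: rate_measurable S_feas j.
under eq_integral do rewrite -sumEFin; under [RHS]eq_integral do rewrite -sumEFin.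
rewrite ge0_integral_sum//; last 2 first.
- move=> j; apply/measurable_EFinP; apply: measurable_funM.
    exact: mwF.
  exact: mrate.
- by move=> j t _; rewrite lee_fin mulr_ge0// (rate_ge0 S_feas).
rewrite ge0_integral_sum//; last by move=> j t _; rewrite lee_fin; case: ifP.
apply: eq_bigr => j _; rewrite patchE_ -integral_mkcond.
apply: (integral_comp_crossing _ _ _ _ _ (mF j) (F_le j) wt_ge0).
- exact: rate_measurable S_feas j.
- exact: rate_ge0 S_feas j.
- exact: S_fin.
- by exists (a j) => t; exact: (rate_eq0 S_feas).
Qed.

Lemma potential_inequality :
  (\int[mu]_t (\sum_j descent j t * rate S1 j t)%:E <=
   \int[mu]_t (\sum_j ascent j t * rate S2 j t)%:E)%E.
Proof.
have [m1 i1] := integral_levels S1_feas S1_fin F1_meas F1_le.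
have [m2 i2] := integral_levels S2_feas S2_fin F2_meas F2_le.
under eq_integral do under eq_bigr do rewrite descentE.
under [leRHS]eq_integral do under eq_bigr do rewrite ascentE.
rewrite i1 i2; apply: ge0_le_integral => //.
- by move=> q _; rewrite lee_fin sumr_ge0// => j _; case: ifP.
- by under eq_fun do rewrite -sumEFin; exact: emeasurable_sum.
- by under eq_fun do rewrite -sumEFin; exact: emeasurable_sum.
- by move=> q _; rewrite lee_fin level_le.
Qed.

End PotentialInequality.

(** * Drift at a fixed time *)

Section PowerInequalities.
Context {R : realType} (alpha : R) (alpha_gt1 : 1 < alpha).

Let a0 : 0 < alpha. Proof. exact: lt_trans alpha_gt1. Qed.
Let ia0 : 0 < alpha^-1. Proof. by rewrite invr_gt0. Qed.
Let ia1 : 0 < 1 - alpha^-1.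
Proof. by rewrite subr_gt0 invf_lt1. Qed.

(** [alpha] times Young's inequality for the conjugate exponents [alpha] and [(1 - alpha^-1)^-1]. *)
Lemma young_powR (x s : R) : 0 <= x -> 0 <= s ->
  alpha * x `^ (1 - alpha^-1) * s <= s `^ alpha + (alpha - 1) * x.
Proof.
move=> x0 s0.
have := @conjugate_powR R s (x `^ (1 - alpha^-1)) alpha (1 - alpha^-1)^-1 s0 (powR_ge0 _ _) a0.
rewrite invr_gt0 invrK -powRrM mulfV ?gt_eqF// powRr1// => /(_ ia1).
rewrite addrCA subrr addr0 => /(_ erefl) H.
rewrite mulrAC -mulrA; apply: le_trans (ler_wpM2l (ltW a0) H) _.
rewrite mulrDr mulrCA divff ?gt_eqF// mulr1 lerD2l mulrCA.
by rewrite mulrBr mulr1 mulfV ?gt_eqF// mulrC.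
Qed.

(** Write [x] as the product of its powers with exponents [1 - alpha^-1] and [alpha^-1], and enlarge
    the second. For [y = n / m] that factor is the algorithm's speed when all servers are busy. *)
Lemma powR_interpolation (x y : R) : 0 <= x -> x <= y ->
  x <= x `^ (1 - alpha^-1) * y `^ alpha^-1.
Proof.
rewrite le_eqVlt => /orP[/eqP <-|x0] xy; first by rewrite mulr_ge0// powR_ge0.
rewrite -{1}(powRr1 (ltW x0)) -{1}(subrK alpha^-1 1) powRD; last first.
  by rewrite (gt_eqF x0) implybT.
apply: ler_wpM2l; first exact: powR_ge0.
by apply: ge0_ler_powR; rewrite ?nnegrE ?(ltW ia0) ?(ltW x0)// (le_trans (ltW x0)).
Qed.

Lemma ler1D_powR (s : R) : 0 <= s -> s <= 1 + s `^ alpha.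
Proof.
move=> s0; have [s1|s1] := leP s 1; first by rewrite (le_trans s1)// lerDl powR_ge0.
by rewrite -{1}(powRr1 s0) ler_wpDl// ler_powR// ltW.
Qed.

End PowerInequalities.

Section ServersPower.
Context {R : realType} {m N : nat} (alpha : R) (a w : 'I_N -> R) (S : schedule R m N).
Context (S_feas : feasible a S).

Lemma card_running_le t : (#|running S t| <= m)%N.
Proof.
have sI : injective (@Some 'I_N) by move=> i j [].
rewrite -(card_imset (mem (running S t)) sI).
rewrite -[X in (_ <= X)%N](card_ord m) -cardsT.
apply: leq_trans (leq_imset_card (fun k => assign S k t) _).
apply: subset_leq_card; apply/fintype.subsetP => x /imsetP[j /runningP[k kj] ->].
by apply/imsetP; exists k.
Qed.

Lemma card_busy_le t : (#|[set k | assign S k t]| <= #|running S t|)%N.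
Proof.
have sI : injective (@Some 'I_N) by move=> i j [].
rewrite -(card_imset (mem (running S t)) sI).
rewrite -(@card_in_imset _ _ (fun k => assign S k t)); last first.
  move=> k k'; rewrite !inE; case kj: (assign S k t) => [j|]// _ _ k'j.
  by case: S_feas => _ _ _ inj _; exact: (inj t k k' j).
apply: subset_leq_card; apply/fintype.subsetP => x /imsetP[k].
rewrite inE; case kj: (assign S k t) => [j|]// _ ->.
by apply/imsetP; exists j => //; apply/runningP; exists k.
Qed.

(** A job runs on at most one server, so its rate is a single speed, and each server is charged to
    at most one job. *)
Lemma sum_rate_powR_le (B : {set 'I_N}) t : alpha != 0 ->
  \sum_(j in B) rate S j t `^ alpha <= \sum_(k < m) power alpha (speed S k t).
Proof.
move=> a0; apply: (@le_trans _ _ (\sum_(j < N) \sum_(k < m)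
    if assign S k t == Some j then power alpha (speed S k t) else 0)).
  rewrite big_mkcond/=; apply: ler_sum => j _.
  have s0 : 0 <= \sum_(k < m) (if assign S k t == Some j then power alpha (speed S k t) else 0).
    by apply: sumr_ge0 => k _; case: ifP => // _; exact: powR_ge0.
  case: ifP => // _; have [/runningP[k kj]|nr] := boolP (j \in running S t).
    rewrite (rate_assigned S_feas kj) (bigD1 k)//= kj eqxx lerDl.
    by apply: sumr_ge0 => k' _; case: ifP => // _; exact: powR_ge0.
  rewrite rate_unassigned ?powR0//; move=> k kj; by apply: (negP nr); apply/runningP; exists k.
rewrite exchange_big/=; apply: ler_sum => k _.
case kj: (assign S k t) => [j|]; last by rewrite big1 ?powR_ge0.
rewrite (bigD1 j)//= eqxx big1 ?addr0// => i ij.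
by case: eqP => // -[] /esym/eqP; rewrite (negPf ij).
Qed.

End ServersPower.

Section Drift.
Context {R : realType} {m N : nat} (alpha : R) (a w : 'I_N -> R) (SA S : schedule R m N).
Context (alpha_gt1 : 1 < alpha) (alpha_lt2 : alpha < 2) (m_gt0 : (0 < m)%N).
Context (SA_alg : alg_schedule alpha a w SA).
Context (SA_fin : forall j t, (work SA j t < +oo)%E).
Context (S_feas : feasible a S).

Let SA_feas : feasible a SA. Proof. by case: SA_alg. Qed.
Let alpha_gt0 : 0 < alpha. Proof. exact: lt_trans alpha_gt1. Qed.
Let m_gt0R : 0 < m%:R :> R. Proof. by rewrite ltr0n. Qed.
Let n t := nalive a w SA t.
Let n_other t := nalive a w S t.
Let c : R := 2 / (2 - alpha).

(** [c] times the derivative of the power function at the speed whose power is [v / m]. *)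
Definition marginal (v : nat) : R := c * (alpha * (v%:R / m%:R) `^ (1 - alpha^-1)).

(** By this choice of [c], [c * alpha = 2 * c - 2] and [c * (alpha - 1) = c - 2], the coefficients
    in [potential_arith]. *)
Let cE : c * (2 - alpha) = 2. Proof. by rewrite /c divfK// gt_eqF// subr_gt0. Qed.
Let c_ge2 : 2 <= c.
Proof. by have al1 := alpha_gt1; rewrite /c ler_pdivlMr ?subr_gt0//; lra. Qed.
Let c_ge0 : 0 <= c. Proof. exact: le_trans c_ge2. Qed.

Lemma marginal0 : marginal 0 = 0.
Proof.
rewrite /marginal mul0r powR0 ?mulr0//.
by rewrite gt_eqF// subr_gt0 invf_lt1.
Qed.

Lemma marginal_ndecr : {homo marginal : x y / (x <= y)%N >-> x <= y}.
Proof.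
move=> x y xy; apply: ler_wpM2l => //; apply: ler_wpM2l; first exact: ltW.
apply: ge0_ler_powR; rewrite ?nnegrE ?divr_ge0 ?ler0n//.
  by rewrite subr_ge0 invf_le1// ltW.
by rewrite ler_pM2r ?invr_gt0// ler_nat.
Qed.

Let marginal_ge0 v : 0 <= marginal v.
Proof. by rewrite -marginal0 marginal_ndecr. Qed.

Let pace (k : nat) : R := if (m <= k)%N then power alpha^-1 (k%:R / m%:R) else 1.

Let pace_ge1 k : 1 <= pace k.
Proof.
rewrite /pace; case: ifP => // mk.
rewrite /power -[leLHS]/((fun=> 1) alpha^-1) -powR1.
apply: ge0_ler_powR; rewrite ?nnegrE ?invr_ge0 ?divr_ge0 ?ler0n ?ler01 ?(ltW alpha_gt0)//.
by rewrite ler_pdivlMr// mul1r ler_nat.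
Qed.

Let running_alive j t : j \in running SA t -> alive a w SA j t.
Proof.
by case: SA_alg => _ /(_ t)[/fintype.subsetP sub _ _ _] /sub; rewrite inE.
Qed.

Let rate_pace j t : j \in running SA t -> rate SA j t = pace (n t).
Proof.
move=> /runningP[k kj]; rewrite (rate_assigned SA_feas kj).
by case: SA_alg => _ /(_ t)[_ _ _ /(_ k)]; rewrite kj.
Qed.

(** For [n >= m], at most [m] busy servers use power [n / m] each; for [n < m], at most [n] of them
    use power 1 each. *)
Lemma alg_power_le t :
  (n t)%:R + \sum_(k < m) power alpha (speed SA k t) <= 2 * (n t)%:R.
Proof.
rewrite mulr_natl mulr2n lerD2l.
have spE k : power alpha (speed SA k t) = if assign SA k t then power alpha (pace (n t)) else 0.
  case: SA_alg => _ /(_ t)[_ _ _ /(_ k) ->]; case: (assign SA k t) => //=.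
  by rewrite /power powR0// gt_eqF.
under eq_bigr do rewrite spE; rewrite -big_mkcond sumr_const/=.
have cb : (#|[pred k | assign SA k t]| <= minn m (n t))%N.
  case: SA_alg => _ /(_ t)[_ <- _ _]; apply: leq_trans (card_busy_le SA_feas t).
  by rewrite cardsE.
rewrite /pace; case: leqP => [mn|nm].
  rewrite /power -powRrM mulVf ?gt_eqF// powRr1 ?divr_ge0//.
  rewrite -[leLHS]mulr_natr mulrAC ler_pdivrMr// ler_wpM2l// ler_nat.
  exact: leq_trans cb (geq_minl _ _).
by rewrite /power powR1/= ler_nat (leq_trans cb)// geq_minr.
Qed.

(** With all servers busy, the served jobs are the lowest in priority, so their ranks are
    consecutive, and [powR_interpolation] makes [marginal] times the speed at least linear.
    Otherwise every alive job is served at speed 1, and the constant 2 alone suffices. *)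
Lemma sum_descent_ge t :
  (if (m <= n t)%N then
     (2 * c - 2) * ((\sum_(i < m) (n t - i - n_other t))%N%:R / m%:R) + 2 * m%:R
   else 2 * (n t)%:R)
  <= \sum_j descent a w SA S marginal 2 j t * rate SA j t.
Proof.
have [_ /(_ t)[sub card_run prio _]] := SA_alg.
have le_run (G : 'I_N -> R) :
    (forall j, j \in running SA t -> G j <= (marginal (job_rank a w SA j t - n_other t) + 2) * pace (n t)) ->
    \sum_(j in running SA t) G j <= \sum_j descent a w SA S marginal 2 j t * rate SA j t.
  move=> GD; rewrite big_mkcond/=; apply: ler_sum => j _; case: ifP => jr.
    by rewrite /descent running_alive// rate_pace//; exact: GD.
  by rewrite mulr_ge0 ?(rate_ge0 SA_feas)//; apply: descent_ge0 => //; [exact: marginal0|exact: marginal_ndecr].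
have h0 v : 0 <= marginal v by [].
case: ifP => mn; last first.
  have nm : (n t < m)%N by rewrite ltnNge mn.
  have {1}-> : (n t)%:R = (#|running SA t|)%:R :> R by rewrite card_run; congr (_%:R); rewrite /n /nalive in nm *; lia.
  rewrite mulr_natr -sumr_const; apply: le_run => j jr.
  rewrite -[leLHS]mulr1; apply: ler_pM => //; by rewrite lerDr.
have rm : #|running SA t| = m by rewrite card_run; move: mn; rewrite /n /nalive; lia.
have sumK : (\sum_(j in running SA t) (job_rank a w SA j t - n_other t) =
   \sum_(i < m) (n t - i - n_other t))%N.
  rewrite /job_rank sum_rank_lower ?rm//; first by move=> i j _ _; exact: priority_inj.
  move=> j i jr iA inr; rewrite lt_neqAle (inj_eq (@priority_inj _ _ _ w SA t)).
  rewrite (_ : j == i = false)/=; last by apply/negP => /eqP ji; move: inr; rewrite -ji jr.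
  have := prio j i jr iA inr; rewrite !(remainingE _ SA_feas)// lee_fin => Xji.
  by rewrite /priority lexi_pair Xji/= jr/= (negPf inr) lexi_pair implybT.
rewrite -sumK natr_sum mulr_suml mulr_sumr.
have -> : 2 * m%:R = \sum_(j in running SA t) 2 :> R by rewrite sumr_const rm mulr_natr.
rewrite -big_split/=; apply: le_run => j jr.
rewrite [leRHS]mulrDl; apply: lerD; last by rewrite ler_peMr.
rewrite /marginal /pace mn /power -[leRHS]mulrA -[X in _ <= _ * X]mulrA.
have -> : 2 * c - 2 = c * alpha by rewrite -[X in _ - X]cE; ring.
rewrite -[X in X <= _]mulrA. apply: ler_wpM2l => //; apply: ler_wpM2l; first exact: ltW.
apply: powR_interpolation => //.
rewrite ler_pM2r ?invr_gt0// ler_nat (leq_trans (leq_subr _ _))//.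
by apply: subset_leq_card; apply/fintype.subsetP => i; rewrite inE => /andP[].
Qed.

(** Only jobs both alive and served contribute, [b] in number. Young's inequality handles
    [marginal], [ler1D_powR] the constant 2, and [sum_rank_upper] the ranks. *)
Lemma sum_ascent_le t : exists2 b : nat, (b <= m)%N /\ (b <= n_other t)%N &
  \sum_j ascent a w SA S marginal 2 j t * rate S j t <=
   (c + 2) * \sum_(k < m) power alpha (speed S k t)
   + (c - 2) * ((\sum_(i < b) (n t - i))%N%:R / m%:R) + 2 * b%:R.
Proof.
pose B := running S t :&: alive_set a w S t.
exists #|B|.
  split; last by apply: subset_leq_card; exact: subsetIr.
  apply: leq_trans (card_running_le S t); apply: subset_leq_card; exact: subsetIl.
apply: (@le_trans _ _ (\sum_(j in B) ((c + 2) * rate S j t `^ alpha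
    + (c - 2) * ((n t - (job_rank a w S j t).-1)%N%:R / m%:R) + 2))).
  rewrite [leRHS]big_mkcond/=; apply: ler_sum => j _; rewrite /B !inE /ascent.
  case: (boolP (alive a w S j t)) => jA; rewrite ?andbF ?mul0r//= andbT.
  have [jr|nr] := boolP (j \in running S t); last first.
    rewrite ifF; last by move: nr; rewrite inE => /negbTE.
    rewrite rate_unassigned ?mulr0// => k kj; by apply: (negP nr); apply/runningP; exists k.
  rewrite ifT; last by move: jr; rewrite inE.
  have r0 := rate_ge0 S_feas j t.
  rewrite -/(n t); set v := (n t - _)%N; set s := rate S j t in r0 *.
  have v0 : 0 <= v%:R / m%:R :> R by rewrite divr_ge0.
  have Y := young_powR alpha_gt1 v0 r0.
  have L := ler1D_powR alpha_gt1 r0.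
  have P0 : 0 <= s `^ alpha by exact: powR_ge0.
  have -> : c - 2 = c * (alpha - 1) by rewrite -[X in _ - X]cE; ring.
  have := ler_wpM2l c_ge0 Y; rewrite /marginal; set x := v%:R / m%:R; set z := x `^ _.
  move=> cY; rewrite mulrDl; apply: (@le_trans _ _ (c * (s `^ alpha + (alpha - 1) * x) + 2 * (1 + s `^ alpha))).
    by apply: lerD; [rewrite -mulrA|rewrite ler_pM2l].
  by rewrite le_eqVlt; apply/orP; left; apply/eqP; ring.
rewrite 2!big_split/= sumr_const -[X in _ + X <= _]mulr_natr; apply: lerD => //.
apply: lerD.
  rewrite -mulr_sumr; apply: ler_wpM2l; first by rewrite addr_ge0.
  by apply: (sum_rate_powR_le S_feas); rewrite gt_eqF.
rewrite -mulr_sumr -mulr_suml -natr_sum; apply: ler_wpM2l; first by rewrite subr_ge0.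
rewrite ler_pM2r ?invr_gt0// ler_nat; apply: sum_rank_upper; first exact: subsetIr.
by move=> i j _ _; exact: priority_inj.
Qed.

(** With all servers busy this is [potential_arith]. If [n < m], each summand of the sum over [b] is
    at most [m], so besides power the ascent is at most [c * n_other]. *)
Lemma drift_le t :
  2 * (n t)%:R + \sum_j ascent a w SA S marginal 2 j t * rate S j t <=
  \sum_j descent a w SA S marginal 2 j t * rate SA j t
  + (3 + c) * ((n_other t)%:R + \sum_(k < m) power alpha (speed S k t)).
Proof.
have [b [bm bo] asc] := sum_ascent_le t.
have := sum_descent_ge t; set D := \sum_j descent _ _ _ _ _ _ _ _ * _.
set P := \sum_(k < m) _ in asc *.
have P0 : 0 <= P by apply: sumr_ge0 => k _; exact: powR_ge0.
have cP0 : 0 <= c * P by rewrite mulr_ge0.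
case: leqP => [mn|nm] desc.
  have := @potential_arith R c (n t) m (n_other t) b c_ge2 m_gt0 mn bm bo.
  nra.
have Sb : (\sum_(i < b) (n t - i))%N%:R / m%:R <= (n_other t)%:R :> R.
  rewrite ler_pdivrMr// -natrM ler_nat.
  apply: (@leq_trans (\sum_(i < b) m)).
    by apply: leq_sum => i _; rewrite (leq_trans (leq_subr _ _))// ltnW.
  by rewrite sum_nat_const card_ord leq_mul.
have bR : b%:R <= (n_other t)%:R :> R by rewrite ler_nat.
have c20 : 0 <= c - 2 by rewrite subr_ge0.
have := ler_wpM2l c20 Sb.
have o0 : 0 <= (n_other t)%:R :> R by rewrite ler0n.
nra.
Qed.

(** A crude bound whose constant depends on [N]; it makes the integral of the ascent finite when the
    other schedule has finite cost. *)
Lemma sum_ascent_bounded t :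
  \sum_j ascent a w SA S marginal 2 j t * rate S j t <=
  (c + 2 + (c - 2) * (N%:R / m%:R))
   * ((n_other t)%:R + \sum_(k < m) power alpha (speed S k t)).
Proof.
have [b [bm bo] asc] := sum_ascent_le t; apply: le_trans asc _.
set P := \sum_(k < m) _.
have P0 : 0 <= P by apply: sumr_ge0 => k _; exact: powR_ge0.
have c20 : 0 <= c - 2 by rewrite subr_ge0.
have bR : b%:R <= (n_other t)%:R :> R by rewrite ler_nat.
have o0 : 0 <= (n_other t)%:R :> R by rewrite ler0n.
have x0 : 0 <= (c - 2) * (N%:R / m%:R) by rewrite mulr_ge0// divr_ge0.
have Sb : (\sum_(i < b) (n t - i))%N%:R / m%:R <= (N%:R / m%:R) * (n_other t)%:R :> R.
  rewrite mulrAC ler_pM2r ?invr_gt0// -natrM ler_nat.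
  apply: (@leq_trans (\sum_(i < b) N)); last first.
    by rewrite sum_nat_const card_ord mulnC leq_mul.
  apply: leq_sum => i _; rewrite (leq_trans (leq_subr _ _))//.
  by rewrite -[leqRHS]card_ord max_card.
have := ler_wpM2l c20 Sb; rewrite mulrA => cSb.
have xP : 0 <= (c - 2) * (N%:R / m%:R) * P by rewrite mulr_ge0.
have co : 0 <= c * (n_other t)%:R by rewrite mulr_ge0.
nra.
Qed.

End Drift.

(** * Integration over time *)

Section FiniteCost.
Context {R : realType} {m N : nat} (alpha : R) (a w : 'I_N -> R).
Local Notation mu := (@lebesgue_measure R).
Context (alpha_gt1 : 1 < alpha).

Definition total_power (S : schedule R m N) (t : R) : R :=
  \sum_(k < m) power alpha (speed S k t).

Lemma total_power_ge0 S t : 0 <= total_power S t.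
Proof. by apply: sumr_ge0 => k _; exact: powR_ge0. Qed.

Lemma total_power_measurable S : feasible a S -> measurable_fun setT (total_power S).
Proof.
case=> _ Sm _ _ _; apply: measurable_sum => k.
exact: (measurableT_comp (measurable_powR alpha) (Sm k)).
Qed.

Lemma alg_work_lty (SA : schedule R m N) : alg_schedule alpha a w SA ->
  forall j t, (work SA j t < +oo)%E.
Proof.
move=> [SA_feas SA_alg].
have C0 : 0 <= 1 + power alpha^-1 (N%:R / m%:R) :> R by rewrite addr_ge0// powR_ge0.
apply: (work_lty SA_feas (f := fun=> 0%E) _ _ _ C0) => //.
  by rewrite integral0.
move=> j t; rewrite adde0 lee_fin.
have [/runningP[k kj]|nr] := boolP (j \in running SA t); last first.
  by rewrite rate_unassigned// => k kj; apply: (negP nr); apply/runningP; exists k.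
rewrite (rate_assigned SA_feas kj).
have [_ _ _ /(_ k) ->] := SA_alg t; rewrite kj.
case: ifP => _; last by rewrite lerDl powR_ge0.
rewrite ler_wpDl// ge0_ler_powR ?nnegrE ?divr_ge0 ?invr_ge0//; first exact: ltW (lt_trans _ alpha_gt1).
rewrite ler_wpM2r ?invr_ge0// ler_nat -[leqRHS]card_ord max_card//.
Qed.

Lemma work_lty_of_power (S : schedule R m N) : feasible a S ->
  (\int[mu]_t (total_power S t)%:E < +oo)%E -> forall j t, (work S j t < +oo)%E.
Proof.
move=> S_feas P_fin.
apply: (work_lty S_feas (f := fun t => (total_power S t)%:E) _ _ P_fin ler01).
- by apply/measurable_EFinP; exact: total_power_measurable.
- by move=> t; rewrite lee_fin total_power_ge0.
move=> j t; rewrite -EFinD lee_fin.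
apply: le_trans (ler1D_powR alpha_gt1 (rate_ge0 S_feas j t)) _; rewrite lerD2l.
have := sum_rate_powR_le S_feas [set j] t (alpha := alpha); rewrite big_set1; apply.
by rewrite gt_eqF// (lt_trans _ alpha_gt1).
Qed.

(** A job that never finishes is alive from [a j] on, which makes the integral of [nalive]
    infinite. *)
Lemma all_jobs_finish (S : schedule R m N) : feasible a S ->
  (forall j t, (work S j t < +oo)%E) ->
  (\int[mu]_t ((nalive a w S t)%:R)%:E < +oo)%E ->
  forall j, exists t, residual w S j t <= 0.
Proof.
move=> S_feas S_fin n_fin j; apply: contrapT => nf.
have pos t : 0 < residual w S j t.
  by rewrite ltNge; apply/negP => r0; apply: nf; exists t.
move: n_fin; apply/negP; rewrite -leNgt.
have -> : +oo%E = (\int[mu]_(t in `[a j, +oo[%classic) (cst 1%E t))%E.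
  by rewrite integral_cst//= mul1e lebesgue_measure_itv/= ltry.
have mn : measurable_fun setT (fun t => ((nalive a w S t)%:R : R)%:E).
  apply/measurable_EFinP.
  exact: (measurableT_comp (f := fun n : nat => n%:R : R) _ (nalive_measurable w S_feas S_fin)).
apply: (@le_trans _ _ (\int[mu]_(t in `[a j, +oo[%classic) ((nalive a w S t)%:R)%:E)%E); last first.
  by apply: ge0_subset_integral => // t _; rewrite lee_fin.
apply: ge0_le_integral => //; first exact: measurable_funTS mn.
move=> t /=; rewrite in_itv/= andbT => at_; rewrite lee_fin ler1n card_gt0.
by apply/set0Pn; exists j; rewrite inE (aliveE _ S_feas)// at_ pos.
Qed.

End FiniteCost.

Theorem theorem2 (R : realType) (alpha : R) (m N : nat)
    (a w : 'I_N -> R) (SA : schedule R m N) :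
  1 < alpha < 2 -> (0 < m)%N -> (forall j, 0 < w j) ->
  alg_schedule alpha a w SA ->
  forall S : schedule R m N, feasible a S ->
    (cost alpha a w SA <= (3 + 2 / (2 - alpha))%:E * cost alpha a w S)%E.
Proof.
move=> /andP[al1 al2] m0 _ SA_alg S S_feas.
pose mu := @lebesgue_measure R.
pose c : R := 2 / (2 - alpha).
have c0 : 0 <= c by rewrite divr_ge0// subr_ge0 ltW.
have c3 : 0 < 3 + c by rewrite ltr_wpDr.
have n_ge0 (S' : schedule R m N) t : (0 <= ((nalive a w S' t)%:R : R)%:E)%E by rewrite lee_fin.
have P_ge0 (S' : schedule R m N) t : (0 <= (total_power alpha S' t)%:E)%E.
  by rewrite lee_fin total_power_ge0.
have costE (S' : schedule R m N) : cost alpha a w S' =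
  (\int[mu]_t ((nalive a w S' t)%:R)%:E + \int[mu]_t (total_power alpha S' t)%:E)%E by [].
(* Infinite cost of [S] is trivial; finite cost gives finite work and completion of all jobs, as the
   potential inequality requires. *)
have [->|cost_fin] := eqVneq (cost alpha a w S) +oo%E.
  by rewrite gt0_muley ?lte_fin// leey.
have : (cost alpha a w S < +oo)%E by rewrite ltey.
rewrite costE => S_cost.
have [nS PS] : (\int[mu]_t ((nalive a w S t)%:R)%:E < +oo)%E /\
   (\int[mu]_t (total_power alpha S t)%:E < +oo)%E.
  split; apply: le_lt_trans S_cost.
    by rewrite leeDl//; exact: integral_ge0.
  by rewrite leeDr//; exact: integral_ge0.
have SA_feas : feasible a SA by case: SA_alg.
have SA_fin := alg_work_lty al1 SA_alg.
have S_fin := work_lty_of_power al1 S_feas PS.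
have S_done := all_jobs_finish S_feas S_fin nS.
have h0 := marginal0 (m := m) al1.
have hn := marginal_ndecr al1 al2 m0.
have mn (S' : schedule R m N) : feasible a S' -> (forall j t, (work S' j t < +oo)%E) ->
    measurable_fun setT (fun t => ((nalive a w S' t)%:R : R)%:E).
  move=> f1 f2; apply/measurable_EFinP.
  exact: (measurableT_comp (f := fun n : nat => n%:R : R) _ (nalive_measurable w f1 f2)).
have mP (S' : schedule R m N) : feasible a S' ->
    measurable_fun setT (fun t => (total_power alpha S' t)%:E).
  by move=> f1; apply/measurable_EFinP; exact: total_power_measurable f1.
pose asc t := (\sum_j ascent a w SA S (@marginal R m alpha) 2 j t * rate S j t).
pose des t := (\sum_j descent a w SA S (@marginal R m alpha) 2 j t * rate SA j t).
have des_asc : (\int[mu]_t (des t)%:E <= \int[mu]_t (asc t)%:E)%E.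
  exact: (potential_inequality SA_feas SA_fin S_feas S_fin S_done h0 hn).
have asc_ge0 t : 0 <= asc t.
  apply: sumr_ge0 => j _; rewrite mulr_ge0 ?(rate_ge0 S_feas)//.
  by apply: ascent_ge0.
have des_ge0 t : 0 <= des t.
  apply: sumr_ge0 => j _; rewrite mulr_ge0 ?(rate_ge0 SA_feas)//.
  by apply: descent_ge0.
have m_asc : measurable_fun setT (fun t => (asc t)%:E).
  apply/measurable_EFinP; apply: measurable_sum => j; apply: measurable_funM.
    exact: ascent_measurable.
  exact: rate_measurable S_feas j.
have m_des : measurable_fun setT (fun t => (des t)%:E).
  apply/measurable_EFinP; apply: measurable_sum => j; apply: measurable_funM.
    exact: descent_measurable.
  exact: rate_measurable SA_feas j.
pose cS t : \bar R := (((nalive a w S t)%:R)%:E + (total_power alpha S t)%:E)%E.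
have cS_ge0 t : (0 <= cS t)%E by rewrite adde_ge0.
have m_cS : measurable_fun setT cS by apply: emeasurable_funD; [exact: mn|exact: mP].
have int_cS : (\int[mu]_t cS t = cost alpha a w S)%E.
  by rewrite /cS ge0_integralD//; [exact: mn|exact: mP].
have asc_fin : (\int[mu]_t (asc t)%:E)%E \is a fin_num.
  rewrite ge0_fin_numE; last by apply: integral_ge0 => t _; rewrite lee_fin.
  pose K : R := c + 2 + (c - 2) * (N%:R / m%:R).
  apply: (@le_lt_trans _ _ (\int[mu]_t (`|K|%:E * cS t))%E).
    apply: ge0_le_integral => //.
    - by move=> t _; rewrite lee_fin.
    - exact: measurable_funeM.
    - move=> t _; rewrite /cS -EFinD -EFinM lee_fin.
      apply: (@le_trans _ _ (K * ((nalive a w S t)%:R + total_power alpha S t))); first exact: (sum_ascent_bounded w SA al1 al2 m0 S_feas t).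
      apply: ler_wpM2r; last exact: ler_norm.
      by rewrite addr_ge0// total_power_ge0.
  rewrite ge0_integralZl_EFin// int_cS.
  by rewrite lte_mul_pinfty// costE.
have m_2n : measurable_fun setT (fun t => (2 * (nalive a w SA t)%:R : R)%:E).
  by under eq_fun do rewrite EFinM; apply: measurable_funeM; exact: mn.
have int_2n : (cost alpha a w SA <= \int[mu]_t (2 * (nalive a w SA t)%:R)%:E)%E.
  rewrite costE -ge0_integralD//; [|exact: mn|exact: mP].
  apply: ge0_le_integral => //.
  - by move=> t _; rewrite adde_ge0.
  - by apply: emeasurable_funD; [exact: mn|exact: mP].
  - by move=> t _; rewrite -EFinD lee_fin; exact: alg_power_le.
(* The integral of [asc], being finite, may be added to both sides; after integrating the drift
   bound, [des_asc] bounds the integral of [des] by it. *)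
apply: (le_trans int_2n); rewrite -(leeD2rE _ _ asc_fin).
rewrite -ge0_integralD//; last by move=> t _; rewrite lee_fin.
apply: (@le_trans _ _ (\int[mu]_t ((des t)%:E + (3 + c)%:E * cS t))%E).
  apply: ge0_le_integral => //.
  - by move=> t _; rewrite adde_ge0// lee_fin// mulr_ge0.
  - exact: emeasurable_funD.
  - by apply: emeasurable_funD => //; exact: measurable_funeM.
  - move=> t _; rewrite (_ : cS t = ((nalive a w S t)%:R + total_power alpha S t)%:E)//.
    rewrite -EFinM -2!EFinD lee_fin.
    exact: drift_le.
have des_ge0' t : (0 <= (des t)%:E)%E by rewrite lee_fin.
have ccS_ge0 t : (0 <= (3 + c)%:E * cS t)%E by rewrite mule_ge0// lee_fin ltW.
have m_ccS : measurable_fun setT (fun t => (3 + c)%:E * cS t)%E by exact: measurable_funeM.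
rewrite ge0_integralD// ge0_integralZl_EFin//; last exact: ltW.
by rewrite int_cS addeC leeD2l.
Qed.
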